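(* Let $k,n,\ell$ be positive integers with $k\le n$, and let $d=n/\gcd(n,\ell)$. There exists a $\rho^\ell$-symmetric weakly separated collection $D\subseteq\binom{[n]}{k}$ of size $k(n-k)+1$ if and only if $k$ is congruent to $-1$, $0$, or $1$ modulo $d$.
   Context: $[n]=\{1,\dots,n\}$ and $\binom{[n]}{k}$ is the set of $k$-element subsets of $[n]$. Two sets $S,T\in\binom{[n]}{k}$ are weakly separated if there are no $a<b<c<e$ in $[n]$ such that $a,c\in S\setminus T$ and $b,e\in T\setminus S$, or $a,c\in T\setminus S$ and $b,e\in S\setminus T$. A collection of such sets is weakly separated if its elements are pairwise weakly separated. For $S\subseteq[n]$, $S+_n\ell$ denotes the set obtained by adding $\ell$ to every element of $S$ modulo $n$ (with residues represented in $[n]$). A collection $D$ is $\rho^\ell$-symmetric if $I+_n\ell\in D$ for every $I\in D$. *)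

(* Defs.v *)
From mathcomp Require Import all_boot ssralg ssrint intdiv.

Set Implicit Arguments.
Unset Strict Implicit.
Unset Printing Implicit Defensive.

(* The set [n] = {1, ..., n} is modelled by 'I_n, with i : 'I_n standing for
   i + 1. This preserves the order, and turns addition modulo n with residues
   in {1, ..., n} into addition modulo n with residues in {0, ..., n - 1}. *)

Definition interlaced (n : nat) (A B : {set 'I_n}) : Prop :=
  exists a b c e : 'I_n,
    [/\ a < b, b < c & c < e] /\ [/\ a \in A, c \in A, b \in B & e \in B].

Definition weakly_separated (n : nat) (S T : {set 'I_n}) : Prop :=
  ~ (interlaced (S :\: T) (T :\: S) \/ interlaced (T :\: S) (S :\: T)).

Definition weakly_separated_collection (n : nat) (D : {set {set 'I_n}}) : Prop :=
  {in D &, forall S T, weakly_separated S T}.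

Definition shift_ord (n l : nat) (i : 'I_n) : 'I_n :=
  Ordinal (ltn_pmod (i + l) (leq_ltn_trans (leq0n i) (ltn_ord i))).

Definition shift_set (n l : nat) (S : {set 'I_n}) : {set 'I_n} :=
  [set shift_ord l i | i in S].

Definition rho_symmetric (n l : nat) (D : {set {set 'I_n}}) : Prop :=
  {in D, forall S, shift_set l S \in D}.

Definition ksubsets (n k : nat) : {set {set 'I_n}} :=
  [set S : {set 'I_n} | #|S| == k].

(* Main.v *)
Require Import Defs.
From mathcomp Require Import all_boot ssralg ssrint intdiv.
From mathcomp Require Import zify.

(** Members of a weakly separated collection [D] of maximum size can be pictured
    as the vertices of a tiling of a disc: the members [x |: K] with a common part
    [K] of size [k - 1] are the corners of a white polygon, the members [L :\ x]
    with a common union [L] of size [k + 1] the corners of a black one. The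
    rotation acts on the disc, and its centre lies in a vertex, a white polygon or
    a black polygon that is invariant. The rotation moves all elements in cycles
    of length [d], so [d] divides the size of an invariant set, and hence divides
    [k], [k - 1] or [k + 1].

    This picture is replaced by counting. Reading the sets from left to right
    gives the bound [k * (n - k) + 1] on the size ([ws_card_le]): each new element
    [y] makes some prefixes branch, and two prefixes of the same size cannot
    branch at the same [y]. When the bound is attained every conceivable branching
    occurs ([branching_exists]), in every circular order of the elements. This
    suffices to show that each edge that is not on the boundary bounds a triangle
    on either side ([edge_completion]). Hence, for a fixed element [b], the edges
    along which [b] is exchanged form a path from one boundary edge to another,
    and comparing its ends counts the white triangles in which [b] is the middle
    corner. Summed over [b], there are exactly [k * (n - k - 1)] white triangles
    ([sum_ext]).

    Invariance of a member of [D], or of the common part of a white triangle,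
    under some power of the rotation that is not the identity implies invariance
    under the rotation itself, since distinct translates would interlace; then [d] divides [k] or [k - 1]. Otherwise
    all orbits are free, so [d] divides both [k * (n - k) + 1] and
    [k * (n - k - 1)], whence [d] divides [k + 1] ([necessity]).

    Conversely, for [k = q * d] or [k = q * d + 1] an invariant collection is built
    in layers ([symmetric_max_ws]). In layer [c < q] the sets contain the residue
    classes modulo [gcdn n l] below [c], an arc starting at some [x], and a longer
    arc starting at [x] restricted to the class [c]; the centre consists of the
    sets containing the classes below [q]. The case [k = -1] modulo [d] follows by
    taking complements. *)

Set Implicit Arguments.
Unset Strict Implicit.
Unset Printing Implicit Defensive.

(** * Crossing chords and relabellings of the circle *)

Definition between (x a c : nat) := (a < x < c) || (c < x < a).

(** Rotations and reflections are used only through the fact that they preserve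
    whether two chords cross; every later argument reads positions off through
    such a relabelling [f], so that the circle can be cut open anywhere and read
    in either direction. *)
Definition dihedral n (f : 'I_n -> 'I_n) :=
  injective f /\
  forall a c b e : 'I_n, a != b -> a != e -> c != b -> c != e ->
    between (f b) (f a) (f c) (+) between (f e) (f a) (f c)
    = between b a c (+) between e a c.

(** The chords [a c] and [b e] cross exactly when one of [b], [e] lies between
    [a] and [c] and the other does not; in this form weak separation is
    symmetric in [S] and [T] and no order of the four points is prescribed. *)
Lemma wsP n (S T : {set 'I_n}) :
  weakly_separated S T <->
  (forall a c b e : 'I_n, a \in S :\: T -> c \in S :\: T ->
    b \in T :\: S -> e \in T :\: S -> between b a c = between e a c).
Proof.
split=> [ws a c b e aS cS bT eT|sep].
  apply/eqP/negPn/negP => neq; apply: ws.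
  have dist x y : x \in S :\: T -> y \in T :\: S -> x != y :> nat.
    rewrite !inE => /andP[xT xS] /andP[yS yT].
    by apply: contraNneq yS => /val_inj <-.
  have ab := dist a b aS bT; have ae := dist a e aS eT.
  have cb := dist c b cS bT; have ce := dist c e cS eT.
  rewrite /between in neq.
  case: (ltnP a c) => ac; case: (ltnP b e) => be.
  - by have [lt|lt] : a < b \/ b < a by [lia|lia]; [left; exists a, b, c, e|right; exists b, a, e, c]; do 2?split=> //; lia.
  - by have [lt|lt] : a < e \/ e < a by [lia|lia]; [left; exists a, e, c, b|right; exists e, a, b, c]; do 2?split=> //; lia.
  - by have [lt|lt] : c < b \/ b < c by [lia|lia]; [left; exists c, b, a, e|right; exists b, c, e, a]; do 2?split=> //; lia.
  - by have [lt|lt] : c < e \/ e < c by [lia|lia]; [left; exists c, e, a, b|right; exists e, c, b, a]; do 2?split=> //; lia.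
case=> -[a [b [c [e [[ab bc ce] [aX cX bX eX]]]]]].
  by move: (sep a c b e aX cX bX eX); rewrite /between; lia.
by move: (sep b e a c bX eX aX cX); rewrite /between; lia.
Qed.

Lemma ws_sym n (S T : {set 'I_n}) : weakly_separated S T -> weakly_separated T S.
Proof. by move=> ws [] X; apply: ws; [right|left]. Qed.

Lemma ws_dihedral n (f : 'I_n -> 'I_n) (S T : {set 'I_n}) (a b c e : 'I_n) :
  dihedral f -> weakly_separated S T ->
  f a < f b -> f b < f c -> f c < f e ->
  a \in S -> a \notin T -> b \in T -> b \notin S ->
  c \in S -> c \notin T -> e \in T -> e \notin S -> False.
Proof.
move=> [_ fX] /wsP sep ab bc ce aS aT bT bS cS cT eT eS.
have := sep a c b e; rewrite !inE aS aT bT bS cS cT eT eS => /(_ isT isT isT isT) eq.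
have neq x y : x \in S -> y \notin S -> x != y by move=> xS; apply: contraNneq => <-.
have := fX a c b e (neq _ _ aS bS) (neq _ _ aS eS) (neq _ _ cS bS) (neq _ _ cS eS).
have ec : (f e < f c) = false by rewrite ltnNge ltnW.
have ea : (f e < f a) = false by rewrite ltnNge ltnW // (ltn_trans ab) // (ltn_trans bc).
by rewrite eq addbb /between ab bc ec ea /= !andbF.
Qed.

Lemma separated_ws n (f : 'I_n -> 'I_n) (S T : {set 'I_n}) u v : dihedral f ->
  {in S :\: T, forall i, u <= f i < v} -> {in T :\: S, forall i, ~~ (u <= f i < v)} ->
  weakly_separated S T.
Proof.
move=> [f_inj fX] inS inT; apply/wsP => a c b e aS cS bT eT.
have neq x y : x \in S :\: T -> y \in T :\: S -> x != y.
  by move=> xS yT; apply: contraTneq xS => ->; move: yT; rewrite !inE => /andP[_ ->].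
have out x : ~~ (u <= f x < v) -> between (f x) (f a) (f c) = false.
  move=> xo; move: (inS a aS) (inS c cS) xo; rewrite /between; clear; lia.
have := fX a c b e (neq _ _ aS bT) (neq _ _ aS eT) (neq _ _ cS bT) (neq _ _ cS eT).
by rewrite !out ?inT //; case: (between b a c); case: (between e a c).
Qed.

Lemma dihedral_id n : dihedral (@id 'I_n).
Proof. by split. Qed.

Lemma dihedral_comp n (f h : 'I_n -> 'I_n) : dihedral f -> dihedral h -> dihedral (h \o f).
Proof.
move=> [fI fX] [hI hX]; split=> [|a c b e ab ae cb ce]; first exact: inj_comp.
by rewrite /= hX ?fX ?(inj_eq fI).
Qed.

Lemma dihedral_rev n : dihedral (@rev_ord n).
Proof.
split=> [|a c b e ab ae cb ce]; first exact: rev_ord_inj.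
have revE (x y z : 'I_n) : between (rev_ord x) (rev_ord y) (rev_ord z) = between x y z.
  have revlt (u v : 'I_n) : (rev_ord u < rev_ord v) = (v < u).
    by have := ltn_ord u; have := ltn_ord v; rewrite /=; lia.
  by rewrite /between !revlt andbC [X in _ || X]andbC orbC [X in X || _]andbC [X in _ || X]andbC.
by rewrite !revE.
Qed.

(** The explicit form of addition modulo [n] makes rotations accessible to
    linear arithmetic. *)
Lemma val_shift n t (i : 'I_n) :
  shift_ord t i = (if i + t %% n < n then i + t %% n else i + t %% n - n) :> nat.
Proof.
have n_gt0 : 0 < n by apply: leq_ltn_trans (ltn_ord i).
rewrite /= -modnDmr; have := ltn_pmod t n_gt0; have := ltn_ord i.
move: (t %% n) => s lt_i lt_s; case: ltnP => [|ge]; first exact: modn_small.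
by rewrite -{1}(subnK ge) modnDr modn_small //; lia.
Qed.

Lemma dihedral_shift n t : dihedral (@shift_ord n t).
Proof.
split=> [i j /(congr1 (@nat_of_ord n))|a c b e ab ae cb ce].
  rewrite !val_shift => eq; apply: val_inj; move: eq.
  have := ltn_pmod t (leq_ltn_trans (leq0n i) (ltn_ord i)).
  move: (ltn_ord i) (ltn_ord j) => lt_i lt_j.
  by case: (ltnP (i + _)) => ?; case: (ltnP (j + _)) => ? /=; lia.
(* Whether x lies between y and z changes under a rotation exactly when one
   of y, z is carried past the cut; this correction does not depend on x. *)
have shiftE (x y z : 'I_n) : y != x -> z != x ->
    between (shift_ord t x) (shift_ord t y) (shift_ord t z)
    = between x y z (+) ((y + t %% n < n) (+) (z + t %% n < n)).
  have := ltn_pmod t (leq_ltn_trans (leq0n x) (ltn_ord x)).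
  rewrite !val_shift -!(inj_eq val_inj) /between /=.
  move: (t %% n) (ltn_ord x) (ltn_ord y) (ltn_ord z) => s.
  move: (x : nat) (y : nat) (z : nat) => {}x {}y {}z lt_x lt_y lt_z lt_s yx zx.
  by case: (ltnP (x + s)) => ?; case: (ltnP (y + s)) => ?; case: (ltnP (z + s)) => ? /=; lia.
by rewrite !shiftE // addbACA addbb addbF.
Qed.

(** * The size bound by counting prefixes *)

Section Prefixes.
Variables (n k : nat) (f : 'I_n -> 'I_n).
Hypothesis f_dih : dihedral f.

Let f_inj : injective f. Proof. exact: f_dih.1. Qed.

Definition below (y : 'I_n) (S : {set 'I_n}) := [set i in S | f i < f y].
Definition above (y : 'I_n) (S : {set 'I_n}) := [set i in S | f y < f i].

Lemma card_split_at y (S : {set 'I_n}) : #|S| = #|below y S| + (y \in S) + #|above y S|.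
Proof.
have -> : below y S = S :&: [set i | f i < f y] by apply/setP=> i; rewrite !inE.
rewrite -(cardsID [set i | f i < f y] S) -addnA; congr (_ + _).
rewrite -(cardsID [set y]) (_ : _ :&: [set y] = if y \in S then [set y] else set0); last first.
  apply/setP=> i; rewrite !inE; case: (altP (i =P y)) => [->|iy].
    by rewrite ltnn andbT; case: ifP; rewrite !inE ?eqxx.
  by rewrite andbF; case: ifP; rewrite !inE ?(negPf iy).
congr (_ + _); first by case: ifP; rewrite ?cards1 ?cards0.
congr #|pred_of_set _|; apply/setP=> i; rewrite !inE -leqNgt ltn_neqAle.
by rewrite (inj_eq val_inj) (inj_eq f_inj) [y == i]eq_sym andbA andbC.
Qed.

Lemma card_pos_lt m : m <= n -> #|[set i | f i < m]| = m.
Proof.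
move=> le_mn; rewrite -(card_imset _ f_inj).
have -> : f @: [set i | f i < m] = [set i : 'I_n | i < m].
  apply/setP=> j; rewrite inE; apply/imsetP/idP => [[i]|lt_jm]; first by rewrite inE => ? ->.
  have [h fK hK] := injF_bij f_inj.
  by exists (h j); rewrite ?inE ?hK.
have -> : #|[set i : 'I_n | i < m]| = #|[set widen_ord le_mn i | i : 'I_m]|.
  apply: eq_card => j; rewrite inE; apply/idP/imsetP => [lt_jm|[i _ ->]]; last by rewrite /= ltn_ord.
  by exists (Ordinal lt_jm); rewrite ?inE //; apply: val_inj.
rewrite card_imset ?card_ord // => i j /(congr1 val) /= ?; exact: val_inj.
Qed.

Lemma card_pos_gt y : #|[set i | f y < f i]| = n - (f y).+1.
Proof.
have := cardsC [set i | f i < (f y).+1].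
rewrite card_pos_lt // card_ord => /(canRL (addKn _)) <-.
by apply: eq_card => i; rewrite !inE ltnS -ltnNge.
Qed.

Variable D : {set {set 'I_n}}.
Hypothesis Dk : D \subset ksubsets n k.
Hypothesis Dws : weakly_separated_collection D.

Lemma ws_member_card S : S \in D -> #|S| = k.
Proof. by move=> /(subsetP Dk); rewrite inE => /eqP. Qed.

Definition prefix_lt m := [set [set i in S | f i < m] | S : {set 'I_n} in D].
(** Passing from the prefixes below position [f y] to those that also record
    [y] duplicates a prefix exactly when it extends both with and without [y]. *)
Definition branching (y : 'I_n) :=
  [set below y S | S in D & y \in S] :&: [set below y S | S in D & y \notin S].

Lemma card_prefix_succ y : #|prefix_lt (f y).+1| = #|prefix_lt (f y)| + #|branching y|.
Proof.
set L := [set below y S | S in D & y \in S].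
set R := [set below y S | S in D & y \notin S].
have yL Q : Q \in L :|: R -> y \notin Q.
  by rewrite inE => /orP[] /imsetP[S _ ->]; rewrite inE ltnn andbF.
have -> : prefix_lt (f y) = L :|: R.
  apply/setP=> Q; rewrite inE; apply/imsetP/orP => [[S SD ->]|].
    by case: (boolP (y \in S)) => yS; [left|right]; apply/imsetP; exists S; rewrite ?inE ?SD ?yS.
  by case=> /imsetP[S]; rewrite inE => /andP[SD _] ->; exists S.
have succE (S : {set 'I_n}) : [set i in S | f i < (f y).+1] = if y \in S then y |: below y S else below y S.
  have E i : (f i < (f y).+1) = (i == y) || (f i < f y).
    by rewrite ltnS leq_eqVlt (inj_eq val_inj) (inj_eq f_inj).
  by case: ifP => yS; apply/setP=> i; rewrite !inE E; case: eqP => //= ->; rewrite yS.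
have -> : prefix_lt (f y).+1 = [set y |: Q | Q in L] :|: R.
  apply/setP=> Q; rewrite inE; apply/imsetP/orP => [[S SD ->]|[]].
  - rewrite succE; case: ifP => yS; [left|right].
      by apply: imset_f; apply/imsetP; exists S; rewrite ?inE ?SD ?yS.
    by apply/imsetP; exists S; rewrite ?inE ?SD ?yS.
  - case/imsetP=> _ /imsetP[S + ->] ->; rewrite inE => /andP[SD yS].
    by exists S; rewrite // succE yS.
  - case/imsetP=> S; rewrite inE => /andP[SD yS] ->.
    by exists S; rewrite // succE (negPf yS).
have AR : [set y |: Q | Q in L] :&: R = set0.
  apply/setP=> Q; rewrite !inE; apply/negP => /andP[/imsetP[Q' _ ->] QR].
  by have := yL (y |: Q'); rewrite inE QR orbT !inE eqxx => /(_ isT).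
have := cardsUI [set y |: Q | Q in L] R; rewrite AR cards0 addn0 => ->.
rewrite card_in_imset ?cardsUI // => Q Q' QL QL' eqQ.
by rewrite -[Q](setU1K (yL Q _)) ?inE ?QL // eqQ setU1K // yL // inE QL'.
Qed.

Lemma branchingP y Q : reflect (exists S S' : {set 'I_n},
    [/\ S \in D, S' \in D, y \in S, y \notin S' & below y S = Q /\ below y S' = Q])
  (Q \in branching y).
Proof.
rewrite inE; apply: (iffP andP) => [[/imsetP[S + ->] /imsetP[S']]|].
  by rewrite !inE => /andP[SD yS] /andP[S'D yS'] eqS; exists S, S'.
case=> S [S' [SD S'D yS yS' [<- eqS]]]; split; apply/imsetP.
  by exists S; rewrite // inE SD.
by exists S'; rewrite // inE S'D.
Qed.

Lemma branching_size y Q : Q \in branching y -> [/\ #|Q| < k, #|Q| <= f y & k + f y < n + #|Q|].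
Proof.
case/branchingP=> S [S' [SD S'D yS yS' [SQ S'Q]]].
have := card_split_at y S; have := card_split_at y S'.
rewrite yS (negPf yS') SQ S'Q (ws_member_card SD) (ws_member_card S'D) => eqS' eqS.
have : #|Q| <= #|[set i | f i < f y]|.
  by rewrite -SQ subset_leq_card //; apply/subsetP=> i; rewrite !inE => /andP[].
have : #|above y S'| <= #|[set i | f y < f i]|.
  by rewrite subset_leq_card //; apply/subsetP=> i; rewrite !inE => /andP[].
rewrite card_pos_gt card_pos_lt; last exact: ltnW.
by move: eqS eqS' (ltn_ord (f y)); clear=> *; split; lia.
Qed.

Lemma neq_card_diff (A B : {set 'I_n}) : #|A| = #|B| -> A != B ->
  exists2 x, x \in A & x \notin B.
Proof.
move=> eqAB neqAB; apply/subsetPn; apply: contraNN neqAB => sAB.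
by rewrite eqEcard sAB eqAB leqnn.
Qed.

Lemma lt_card_diff (A B : {set 'I_n}) : #|B| < #|A| -> exists2 x, x \in A & x \notin B.
Proof. by move=> lt; apply/subsetPn; apply: contraTN lt => /subset_leq_card; rewrite -leqNgt. Qed.

(** If two branching prefixes had the same size, an element [z] of the first
    and an element [w] of the second, followed by [y] and by a compensating later
    element, would cross: if [z] comes first in the pair using [y] after the
    first prefix, otherwise in the pair using [y] after the second. *)
Lemma branching_card_inj y : {in branching y &, injective (fun Q : {set 'I_n} => #|Q|)}.
Proof.
move=> Q1 Q2 /branchingP[S1 [S1' [S1D S1'D yS1 yS1' [eS1 eS1']]]].
case/branchingP=> [S2 [S2' [S2D S2'D yS2 yS2' [eS2 eS2']]]] eq12.
apply/eqP; apply/negPn/negP => neq12.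
have [z zQ1 zQ2] := neq_card_diff eq12 neq12.
have [w wQ2 wQ1] : exists2 x, x \in Q2 & x \notin Q1.
  by apply: neq_card_diff; rewrite 1?eq_sym.
have f12 : #|above y S1| < #|above y S2'|.
  have := card_split_at y S1; have := card_split_at y S2'.
  by rewrite yS1 (negPf yS2') eS1 eS2' (ws_member_card S1D) (ws_member_card S2'D); move: eq12; clear; lia.
have f21 : #|above y S2| < #|above y S1'|.
  have := card_split_at y S2; have := card_split_at y S1'.
  by rewrite yS2 (negPf yS1') eS2 eS1' (ws_member_card S2D) (ws_member_card S1'D); move: eq12; clear; lia.
have [t] := lt_card_diff f12; rewrite !inE => /andP[tS2' yt] /nandP tS1.
have {}tS1 : t \notin S1 by case: tS1; rewrite ?yt.
have [u] := lt_card_diff f21; rewrite !inE => /andP[uS1' yu] /nandP uS2.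
have {}uS2 : u \notin S2 by case: uS2; rewrite ?yu.
have [zy wy] : f z < f y /\ f w < f y.
  by move: zQ1 wQ2; rewrite -eS1 -eS2 !inE => /andP[_ ->] /andP[_ ->].
move: zQ1 zQ2 wQ1 wQ2.
rewrite -{1}eS1 -{1}eS2' -{1}eS1 -{1}eS2' !inE zy wy !andbT => zS1 zS2' wS1 wS2'.
have : f z != f w :> nat.
  by rewrite (inj_eq val_inj) (inj_eq f_inj); apply: contraNneq wS1 => <-.
rewrite neq_ltn => /orP[zw|wz].
  exact: (@ws_dihedral _ f S1 S2' z w y t f_dih (Dws S1D S2'D)).
have eS : (z \in S1') * (z \in S2 = false) * (w \in S2) * (w \in S1' = false).
  have E (S S' : {set 'I_n}) x : below y S = below y S' -> f x < f y -> (x \in S) = (x \in S').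
    by move=> /setP /(_ x); rewrite !inE => eqx lt; move: eqx; rewrite lt !andbT.
  rewrite (E S1' S1) ?(E S2 S2') ?(E S1' S1) ?eS1 ?eS2 //.
  by rewrite zS1 (negPf zS2') wS2' (negPf wS1).
by apply: (@ws_dihedral _ f S2 S1' w z y u f_dih (Dws S2D S1'D)); rewrite ?eS.
Qed.

Definition feasible (y : 'I_n) := [set j : 'I_n.+1 | [&& j < k, j <= f y & k + f y < n + j]].

Lemma sum_feasible : k <= n -> \sum_y #|feasible y| = k * (n - k).
Proof.
move=> le_kn.
have -> : \sum_y #|feasible y| = \sum_(j < n.+1) #|[set y | j \in feasible y]|.
  under eq_bigr do rewrite -sum1_card big_mkcond /=.
  by rewrite exchange_big /=; apply: eq_bigr => j _; rewrite -sum1_card [RHS]big_mkcond; apply: eq_bigr => y _; rewrite inE.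
have cardE (j : 'I_n.+1) : #|[set y | j \in feasible y]| = (j < k) * (n - k).
  case: ltnP => [lt_jk|le_kj]; last first.
    by rewrite (_ : [set _ | _] = set0) ?cards0 //; apply/setP=> y; rewrite !inE ltnNge le_kj.
  have := cardsID [set y | f y < j] [set y | f y < j + (n - k)].
  rewrite card_pos_lt; last by lia.
  rewrite (_ : _ :&: _ = [set y | f y < j]); last first.
    by apply/setP=> y; rewrite !inE andbC; apply: andb_idr; lia.
  rewrite card_pos_lt; last by lia.
  rewrite (_ : _ :\: _ = [set y | j \in feasible y]); first by lia.
  by apply/setP=> y; rewrite !inE lt_jk /=; lia.
under eq_bigr do rewrite cardE.
rewrite -big_distrl /=; congr (_ * _).
have sum_lt m : \sum_(j < m) (j < k : nat) = minn m k.
  by elim: m => [|m IHm]; rewrite ?big_ord0 ?min0n // big_ord_recr /= IHm; case: ltnP; lia.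
by rewrite sum_lt; apply/minn_idPr; exact: leqW.
Qed.

Lemma card_branching_le y : k <= n -> #|branching y| <= #|feasible y|.
Proof.
move=> le_kn; pose g (Q : {set 'I_n}) : 'I_n.+1 := inord #|Q|.
have gE Q : Q \in branching y -> g Q = #|Q| :> nat.
  by move=> /branching_size[lt_Qk _ _]; rewrite inordK //; lia.
rewrite -(card_in_imset (f := g)) => [|Q Q' QA Q'A eqg].
  apply/subset_leq_card/subsetP=> _ /imsetP[Q QA ->]; rewrite inE (gE _ QA).
  by apply/and3P; exact: branching_size QA.
by apply: (branching_card_inj QA Q'A); rewrite -(gE _ QA) -(gE _ Q'A) eqg.
Qed.

Lemma card_prefix m : m <= n ->
  #|prefix_lt m| = #|prefix_lt 0| + \sum_(y | f y < m) #|branching y|.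
Proof.
elim: m => [_|m IHm lt_mn]; first by rewrite big_pred0 ?addn0 // => y; rewrite ltn0.
have [h fK hK] := injF_bij f_inj.
have fy : f (h (Ordinal lt_mn)) = m :> nat by rewrite hK.
rewrite -{1}fy card_prefix_succ fy (IHm (ltnW lt_mn)) [in RHS](bigD1 (h (Ordinal lt_mn))) ?fy //=.
rewrite -addnA; congr (_ + _); rewrite addnC; congr (_ + _); apply: eq_bigl => y.
by rewrite ltnS (ltn_neqAle _ m) andbC -{2}fy (inj_eq val_inj) (inj_eq f_inj).
Qed.

Lemma card_branching_sum S0 : S0 \in D -> #|D| = 1 + \sum_y #|branching y|.
Proof.
move=> S0D; have <- : prefix_lt n = D.
  rewrite /prefix_lt (eq_imset (g := id)) ?imset_id // => S.
  by apply/setP=> i; rewrite inE ltn_ord andbT.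
rewrite card_prefix // (_ : prefix_lt 0 = [set set0]) ?cards1.
  by congr (_ + _); apply: eq_bigl => y; rewrite ltn_ord.
apply/setP=> Q; rewrite inE; apply/imsetP/eqP => [[S _ ->]|->].
  by apply/setP=> i; rewrite !inE andbF.
by exists S0 => //; apply/setP=> i; rewrite !inE andbF.
Qed.

(** For each [y] the sizes of branching prefixes are distinct and feasible, and
    there are [k * (n - k)] feasible pairs of a position and a size. *)
Lemma ws_card_le : k <= n -> #|D| <= k * (n - k) + 1.
Proof.
move=> le_kn; have [->|[S0 S0D]] := set_0Vmem D; first by rewrite cards0.
rewrite (card_branching_sum S0D) addnC leq_add2r -sum_feasible //.
by apply: leq_sum => y _; apply: card_branching_le.
Qed.

(** Equality in the size bound forces every feasible size to occur at every
    [y]. Every member of a maximum collection other than an interval is found in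
    this way. *)
Lemma branching_exists (y : 'I_n) j : k <= n -> #|D| = k * (n - k) + 1 ->
    j < k -> j <= f y -> k + f y < n + j ->
  exists S S' : {set 'I_n}, [/\ S \in D, S' \in D, y \in S, y \notin S' &
    #|below y S| = j /\ forall i, f i < f y -> (i \in S) = (i \in S')].
Proof.
move=> le_kn cardD lt_jk le_jy lt_y.
have D_gt0 : 0 < #|D| by rewrite cardD addn1.
have [S0 S0D] := card_gt0P D_gt0.
have eq_card_y : #|branching y| = #|feasible y|.
  have arith a b c e : a <= b -> c <= e -> b + e = a + c -> a = b by clear; lia.
  have := card_branching_sum S0D; rewrite cardD addnC => /addnI; rewrite -sum_feasible //.
  rewrite (bigD1 y) //= [in RHS](bigD1 y) //=; apply: arith; first exact: card_branching_le.
  by apply: leq_sum => i _; apply: card_branching_le.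
pose g (Q : {set 'I_n}) : 'I_n.+1 := inord #|Q|.
have gE Q : Q \in branching y -> g Q = #|Q| :> nat.
  by move=> /branching_size[lt_Qk _ _]; rewrite inordK //; lia.
have g_onto : g @: branching y = feasible y.
  apply/eqP; rewrite eqEcard; apply/andP; split.
    apply/subsetP=> _ /imsetP[Q QA ->]; rewrite inE (gE _ QA).
    by apply/and3P; exact: branching_size QA.
  rewrite card_in_imset ?eq_card_y // => Q Q' QA Q'A eqg.
  by apply: (branching_card_inj QA Q'A); rewrite -(gE _ QA) -(gE _ Q'A) eqg.
have lt_jn : j < n.+1 by apply: leq_trans lt_jk (leqW le_kn).
have : Ordinal lt_jn \in feasible y by rewrite inE lt_jk le_jy.
rewrite -g_onto => /imsetP[Q QA /(congr1 val)]; rewrite /= gE // => jQ.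
have [S [S' [SD S'D yS yS' [SQ S'Q]]]] := branchingP _ _ QA.
exists S, S'; split=> //; split=> [|i lt_iy]; first by rewrite SQ.
by have := S'Q; rewrite -SQ => /setP /(_ i); rewrite !inE lt_iy !andbT.
Qed.

End Prefixes.

(** * Completing an edge to a triangle *)

Definition max_ws n k (D : {set {set 'I_n}}) :=
  [/\ k <= n, D \subset ksubsets n k, weakly_separated_collection D
    & #|D| = k * (n - k) + 1].

Section Local.
Variables (n k : nat) (f : 'I_n -> 'I_n).
Hypothesis f_dih : dihedral f.
Variable D : {set {set 'I_n}}.
Hypothesis D_max : max_ws k D.

Lemma max_ws_card S : S \in D -> #|S| = k.
Proof. by case: D_max => _ Dk _ _; apply: ws_member_card. Qed.

Lemma max_ws_cross (S T : {set 'I_n}) (a b c e : 'I_n) : S \in D -> T \in D ->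
  f a < f b -> f b < f c -> f c < f e ->
  a \in S -> a \notin T -> b \in T -> b \notin S ->
  c \in S -> c \notin T -> e \in T -> e \notin S -> False.
Proof. by case: D_max => _ _ Dws _ SD TD; apply: ws_dihedral => //; exact: Dws. Qed.

Lemma above_diff y (S T : {set 'I_n}) : #|above f y S| < #|above f y T| ->
  exists2 t, f y < f t & t \in T /\ t \notin S.
Proof.
move=> /lt_card_diff[t]; rewrite !inE => /andP[tT yt]; rewrite yt andbT.
by exists t.
Qed.

Lemma below_diff y (S T : {set 'I_n}) : #|below f y S| = #|below f y T| ->
  below f y S != below f y T -> exists2 t, f t < f y & t \in S /\ t \notin T.
Proof.
move=> eqST /(neq_card_diff eqST)[t]; rewrite !inE => /andP[tS yt]; rewrite yt andbT.
by exists t.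
Qed.

(** The prefix of [C] below [y] branches at [y]. Some prefix of its size does;
    suppose that it contains [z] in place of [w]. Weak separation of [C] from the
    member with [y] puts [w] before [z], and then the member without [y] crosses
    [A] or [B], whichever does not contain [z]: both cannot, as they add
    different elements to [C]. *)
Lemma extend_agreement (A B C : {set 'I_n}) (a b y : 'I_n) :
    A \in D -> B \in D -> C \in D -> y \in A -> y \in B -> y \notin C ->
    a != b -> a \notin C -> b \notin C -> f a < f y -> f b < f y ->
    (forall i, f i < f y -> (i \in A) = (i == a) || (i \in C)) ->
    (forall i, f i < f y -> (i \in B) = (i == b) || (i \in C)) ->
  exists2 S, S \in D & y \in S /\ forall i, f i < f y -> (i \in S) = (i \in C).
Proof.
move=> AD BD CD yA yB yC ab aC bC ay bY eqA eqB.
have [le_kn Dk Dws cardD] := D_max.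
have addE (x : 'I_n) (X : {set 'I_n}) : x \notin C -> f x < f y ->
    (forall i, f i < f y -> (i \in X) = (i == x) || (i \in C)) ->
    #|below f y X| = #|below f y C|.+1.
  move=> xC xy eqX; have := cardsU1 x (below f y C); rewrite inE (negPf xC) add1n => <-.
  congr #|pred_of_set _|; apply/setP=> i; rewrite !inE.
  by case: (ltnP (f i) (f y)) => [/eqX ->|]; rewrite ?andbT // !andbF orbF; case: eqP => // ->; rewrite leqNgt xy.
have cardA := card_split_at f_dih y A; rewrite yA (addE a) // (max_ws_card AD) in cardA.
have cardB := card_split_at f_dih y B; rewrite yB (addE b) // (max_ws_card BD) in cardB.
have cardC := card_split_at f_dih y C; rewrite (negPf yC) (max_ws_card CD) in cardC.
have le_jy : #|below f y C| <= f y.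
  rewrite -[leqRHS](card_pos_lt f_dih) ?subset_leq_card 1?ltnW //.
  by apply/subsetP=> i; rewrite !inE => /andP[].
have le_uy : #|above f y C| <= n - (f y).+1.
  rewrite -(card_pos_gt f_dih) subset_leq_card //.
  by apply/subsetP=> i; rewrite !inE => /andP[].
have lt_jk : #|below f y C| < k by move: cardA; clear; lia.
have lt_kn : k + f y < n + #|below f y C|.
  by move: cardC le_uy (ltn_ord (f y)); clear; lia.
have [S [S' [SD S'D yS yS' [cardS eqSS']]]] :=
  branching_exists f_dih Dk Dws le_kn cardD lt_jk le_jy lt_kn.
have [eqSC|neqSC] := boolP (below f y S == below f y C).
  exists S => //; split=> // i lt_iy.
  by have := eqP eqSC => /setP/(_ i); rewrite !inE lt_iy !andbT.
have [z zy [zS zC]] := below_diff cardS neqSC.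
have [w wy [wC wS]] : exists2 t, f t < f y & t \in C /\ t \notin S.
  by apply: below_diff; rewrite // eq_sym.
have cardS2 := card_split_at f_dih y S; rewrite yS cardS (max_ws_card SD) in cardS2.
have cardS'2 := card_split_at f_dih y S'; rewrite (negPf yS') (max_ws_card S'D) in cardS'2.
rewrite (_ : below f y S' = below f y S) ?cardS in cardS'2; last first.
  by apply/setP=> i; rewrite !inE; case: (ltnP (f i)) => [/eqSS' ->|]; rewrite ?andbF.
have : f z != f w :> nat.
  by rewrite (inj_eq val_inj) (inj_eq f_dih.1); apply: contraNneq wS => <-.
rewrite neq_ltn => /orP[zw|wz].
  have [|t yt [tC tS]] := @above_diff y S C; first by move: cardS2 cardC; clear; lia.
  by case: (max_ws_cross (a := z) (b := w) (c := y) (e := t) SD CD).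
rewrite eqSS' // in zS; rewrite eqSS' // in wS.
have final (X : {set 'I_n}) x : X \in D -> y \in X -> z != x ->
    (forall i, f i < f y -> (i \in X) = (i == x) || (i \in C)) ->
    #|above f y X| < #|above f y S'| -> False.
  move=> XD yX zx eqX lt_above; have [t yt [tS' tX]] := above_diff lt_above.
  have wX : w \in X by rewrite eqX // wC orbT.
  have zX : z \notin X by rewrite eqX // negb_or zx.
  exact: (max_ws_cross (a := w) (b := z) (c := y) (e := t) XD S'D).
case: (altP (z =P a)) => za; last first.
  by case: (final A a) => //; move: cardA cardS'2; clear; lia.
by case: (final B b) => //; rewrite ?za //; move: cardB cardS'2; clear; lia.
Qed.

End Local.

Lemma max_ws_compl n k (D : {set {set 'I_n}}) :
  max_ws k D -> max_ws (n - k) [set ~: S | S in D].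
Proof.
case=> le_kn Dk Dws cardD; split.
- exact: leq_subr.
- apply/subsetP=> _ /imsetP[S SD ->]; rewrite inE.
  by have := cardsC S; rewrite card_ord (ws_member_card Dk SD) => /(canRL (addKn _)) ->.
- move=> _ _ /imsetP[S SD ->] /imsetP[T TD ->].
  have -> : forall A B : {set 'I_n}, weakly_separated (~: A) (~: B) <-> weakly_separated B A.
    by move=> A B; rewrite /weakly_separated !setDE !setCK ![_ :&: ~: _]setIC.
  exact: Dws.
- by rewrite card_imset ?cardD; [rewrite subKn // mulnC|exact: setC_inj].
Qed.

Lemma surj_pos n (f : 'I_n -> 'I_n) m : dihedral f -> m < n -> exists y, f y = m :> nat.
Proof.
move=> [f_inj _] lt_mn; have [h _ hK] := injF_bij f_inj.
by exists (h (Ordinal lt_mn)); rewrite hK.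
Qed.

Lemma pos_inj n (f : 'I_n -> 'I_n) x y : dihedral f -> f x = f y :> nat -> x = y.
Proof. by move=> [f_inj _] /val_inj /f_inj. Qed.

(** [C] agrees with [K] before [a]; the elements where they differ lie in a
    window [[lo, hi]] after [a], which is narrowed from either end. An end of the
    window that belongs to [K] is given to [C] by [extend_agreement], in the
    relabelling that starts beyond the other end and reaches this end from
    outside the window.
    When both ends belong to [C] but not to [K], nothing of [K] can be missing
    from [C] between them, so the window has shrunk to one added element. *)
Lemma white_nbr_of_agreement n k (f : 'I_n -> 'I_n) (D : {set {set 'I_n}}) (K C : {set 'I_n}) (a b : 'I_n) :
    dihedral f -> max_ws k D -> f b = 0 :> nat -> a != b -> a \notin K -> b \notin K ->
    a |: K \in D -> b |: K \in D -> C \in D -> a \notin C ->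
    (forall i, f i < f a -> (i \in C) = (i \in K)) ->
  exists2 c, f a < f c & c \notin K /\ c |: K \in D.
Proof.
move=> f_dih D_max fb0 ab aK bK AD BD CD aC eqCK.
have lt_ba : f b < f a.
  rewrite fb0 lt0n; apply: contraNneq ab => fa0; apply/eqP/(pos_inj f_dih).
  by rewrite fa0 fb0.
have cardK : k = #|K|.+1 by rewrite -(max_ws_card D_max AD) cardsU1 aK.
have : exists m lo hi, [/\ hi < lo + m, hi < n, f a < lo &
    forall i, ~~ (lo <= f i <= hi) -> (i \in C) = (i \in K)].
  exists n, (f a).+1, n.-1; split=> //; try by have := ltn_ord (f a); clear; lia.
  move=> i; rewrite (_ : f i <= n.-1) ?andbT -?leqNgt; last first.
    by have := ltn_ord (f i); clear; lia.
  rewrite leq_eqVlt => /orP[/eqP/(pos_inj f_dih) ->|]; last exact: eqCK.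
  by rewrite (negPf aC) (negPf aK).
case=> m; elim: m C CD {aC eqCK} => [|m IHm] C CD [lo [hi [lt_hi hi_n a_lo eqCK]]].
  have eqC : C = K by apply/setP=> i; apply: eqCK; move: lt_hi; clear; lia.
  by have := max_ws_card D_max CD; rewrite eqC cardK; clear; lia.
have [lt_hl|le_lh] := ltnP hi lo.
  apply: (IHm C CD); exists lo, hi; split=> //; move: lt_hl; clear; lia.
have step y f2 : dihedral f2 -> (forall i, (f2 i < f2 y) = ~~ (lo <= f i <= hi)) ->
    y \in K -> y \notin C ->
    exists2 S, S \in D & y \in S /\ forall i, ~~ (lo <= f i <= hi) -> (i \in S) = (i \in K).
  move=> f2_dih f2E yK yC.
  have out x : f x < lo -> ~~ (lo <= f x <= hi) by rewrite negb_and -ltnNge => ->.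
  have aO := out a a_lo; have bO := out b (ltn_trans lt_ba a_lo).
  have [S SD [yS eqS]] : exists2 S, S \in D & y \in S /\ forall i, f2 i < f2 y -> (i \in S) = (i \in C).
    apply: (@extend_agreement n k f2 f2_dih D D_max _ _ C a b y AD BD CD) => // [||||||i|i];
      rewrite ?inE ?yK ?orbT ?f2E ?(eqCK _ aO) ?(eqCK _ bO) //.
      by move/eqCK=> ->.
    by move/eqCK=> ->.
  exists S => //; split=> // i iO; rewrite eqS ?f2E //; exact: eqCK.
have [y fy] := surj_pos f_dih (leq_ltn_trans le_lh hi_n).
have [e fe] := surj_pos f_dih hi_n.
have [yCK|yCK] := boolP ((y \in C) == (y \in K)).
  apply: (IHm C CD); exists lo.+1, hi; split=> //; try by move: lt_hi a_lo; clear; lia.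
  move=> i; have [/(pos_inj f_dih) -> _|neq] := eqVneq (f i : nat) (f y); first exact/eqP.
  by move=> out; apply: eqCK; move: neq out; rewrite fy; clear; lia.
(* Start the circle just after hi, so that everything outside the window
   precedes y. *)
have [yK|yK] := boolP (y \in K).
  have yC : y \notin C by move: yCK; rewrite yK; case: (y \in C).
  have [||S SD [yS eqS]] := @step y (@shift_ord n (n.-1 - hi) \o f) _ _ yK yC.
  - exact: dihedral_comp (dihedral_shift _ _).
  - move=> i; rewrite /= -[_ %% _]/(nat_of_ord (shift_ord (n.-1 - hi) (f i))).
    rewrite -[X in _ < X]/(nat_of_ord (shift_ord (n.-1 - hi) (f y))) !val_shift.
    rewrite modn_small ?fy; last by move: hi_n; clear; lia.
    move: hi_n le_lh (ltn_ord (f i)); move: (f i : nat) => u; clear.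
    by case: (ltnP (u + _)) => ?; case: (ltnP (lo + _)) => ?; lia.
  apply: (IHm S SD); exists lo.+1, hi; split=> //; try by move: lt_hi a_lo; clear; lia.
  move=> i; have [/(pos_inj f_dih) -> _|neq] := eqVneq (f i : nat) (f y); first by rewrite yS yK.
  by move=> out; apply: eqS; move: neq out; rewrite fy; clear; lia.
have yC : y \in C by move: yCK; rewrite (negPf yK); case: (y \in C).
have [eCK|eCK] := boolP ((e \in C) == (e \in K)).
  apply: (IHm C CD); exists lo, hi.-1; split=> //; try by move: lt_hi a_lo le_lh hi_n; clear; lia.
  move=> i; have [/(pos_inj f_dih) -> _|neq] := eqVneq (f i : nat) (f e); first exact/eqP.
  by move=> out; apply: eqCK; move: neq out; rewrite fe; clear; lia.
(* Read the circle backwards from just before lo. *)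
have [eK|eK] := boolP (e \in K).
  have eC : e \notin C by move: eCK; rewrite eK; case: (e \in C).
  have [||S SD [eS eqS]] := @step e (@rev_ord n \o (@shift_ord n (n - lo) \o f)) _ _ eK eC.
  - apply: dihedral_comp (dihedral_rev _).
    exact: dihedral_comp (dihedral_shift _ _).
  - move=> i; rewrite [in LHS]/= -[(f i + _) %% _]/(nat_of_ord (shift_ord (n - lo) (f i))).
    rewrite -[(f e + _) %% _]/(nat_of_ord (shift_ord (n - lo) (f e))) !val_shift.
    rewrite modn_small ?fe; last by move: le_lh hi_n a_lo; clear; lia.
    have := leq_ltn_trans (leq0n _) a_lo; move: hi_n le_lh (ltn_ord (f i)).
    move: (f i : nat) => u; clear.
    by case: (ltnP (u + _)) => ?; case: (ltnP (hi + _)) => ?; lia.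
  apply: (IHm S SD); exists lo, hi.-1; split=> //; try by move: lt_hi a_lo le_lh hi_n; clear; lia.
  move=> i; have [/(pos_inj f_dih) -> _|neq] := eqVneq (f i : nat) (f e); first by rewrite eS eK.
  by move=> out; apply: eqS; move: neq out; rewrite fe; clear; lia.
have eC : e \in C by move: eCK; rewrite (negPf eK); case: (e \in C).
have sKC : K \subset C.
  apply/subsetP=> x xK; apply/negPn/negP => xC.
  have xI : lo <= f x <= hi by apply: contraNT xC => /eqCK ->.
  have neq u : u \notin K -> (f x == f u :> nat) = false.
    by move=> uK; apply: contraNF uK => /eqP/(pos_inj f_dih) <-.
  have yx : f y < f x by move: xI (neq y yK); rewrite fy; clear; lia.
  have xe : f x < f e by move: xI (neq e eK); rewrite fe; clear; lia.
  have aC : a \notin C.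
    by rewrite eqCK // negb_and -ltnNge a_lo.
  have notA u : u \notin K -> f a < f u -> u \notin a |: K.
    by move=> uK lt; rewrite !inE (negPf uK) orbF; apply: contraTneq lt => ->; rewrite ltnn.
  apply: (@max_ws_cross n k f f_dih D D_max (a |: K) C a y x e) => //.
  - by rewrite fy.
  - by rewrite setU11.
  - by apply: notA; rewrite ?fy.
  - by rewrite inE xK orbT.
  - by apply: notA; rewrite ?fe // (leq_trans a_lo).
exists y; first by rewrite fy.
split=> //; suff -> : y |: K = C by [].
apply/eqP; rewrite eqEcard subUset sub1set yC sKC /= cardsU1 yK.
by rewrite (max_ws_card D_max CD) cardK add1n.
Qed.

Section Edge.
Variables (n : nat) (f : 'I_n -> 'I_n) (K : {set 'I_n}) (a b : 'I_n).
Hypotheses (f_dih : dihedral f) (fb0 : f b = 0 :> nat).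
Hypotheses (ab : a != b) (aK : a \notin K) (bK : b \notin K).

Lemma edge_lt : f b < f a.
Proof.
rewrite fb0 lt0n; apply: contraNneq ab => fa0; apply/eqP/(pos_inj f_dih).
by rewrite fa0 fb0.
Qed.

(** With the circle cut at [b], the third corners of the triangles lying on the
    far side of the edge joining [a |: K] and [b |: K]: in a white triangle an
    element is added to the common part [K], in a black one an element is removed
    from the union. *)
Definition white_nbr (D : {set {set 'I_n}}) c := [&& f a < f c, c \notin K & c |: K \in D].
Definition black_nbr (D : {set {set 'I_n}}) c :=
  [&& f c < f a, c \in K & (a |: (b |: K)) :\ c \in D].

(** Complementing exchanges white and black triangles; the edge then has common
    part [opp_core], and the same side of it is seen when the circle is cut at [a]
    instead of [b]. *)
Definition opp_pos := @shift_ord n (n - f a) \o f.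
Definition opp_core := ~: (a |: (b |: K)).

Lemma opp_pos_dih : dihedral opp_pos.
Proof. exact: dihedral_comp (dihedral_shift _ _). Qed.

Lemma opp_posE i : opp_pos i = (if f i < f a then f i + n - f a else f i - f a) :> nat.
Proof.
rewrite /opp_pos -[LHS]/(nat_of_ord (shift_ord (n - f a) (f i))) val_shift.
have := edge_lt; rewrite fb0 => fa_gt0; rewrite modn_small; last first.
  by move: fa_gt0 (ltn_ord (f a)); clear; lia.
move: fa_gt0 (ltn_ord (f i)) (ltn_ord (f a)); clear.
by case: (ltnP (f i + _)) => ?; case: (ltnP (f i) (f a)) => ?; lia.
Qed.

Lemma opp_pos_lt i : (opp_pos i < opp_pos b) = (f a <= f i).
Proof.
rewrite !opp_posE edge_lt fb0.
by move: (ltn_ord (f i)) (ltn_ord (f a)); clear; case: (ltnP (f i) (f a)) => ?; lia.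
Qed.

Lemma opp_pos_gt i : (opp_pos b < opp_pos i) = (f b < f i < f a).
Proof.
rewrite !opp_posE edge_lt fb0.
by move: (ltn_ord (f i)) (ltn_ord (f a)); clear; case: (ltnP (f i) (f a)) => ?; lia.
Qed.

Lemma opp_core_b : b |: opp_core = ~: (a |: K).
Proof.
apply/setP=> i; rewrite !inE; case: eqP => [->|] //=.
by rewrite (negPf bK) orbF eq_sym ab.
Qed.

Lemma opp_core_a : a |: opp_core = ~: (b |: K).
Proof.
apply/setP=> i; rewrite !inE; case: eqP => [->|] //=.
by rewrite (negPf aK) orbF ab.
Qed.

End Edge.

Arguments opp_core {n}.

Section EdgeCompletion.
Variables (n k : nat) (f : 'I_n -> 'I_n) (D : {set {set 'I_n}}).
Variables (K : {set 'I_n}) (a b : 'I_n).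
Hypotheses (f_dih : dihedral f) (D_max : max_ws k D) (fb0 : f b = 0 :> nat).
Hypotheses (ab : a != b) (aK : a \notin K) (bK : b \notin K).
Hypotheses (AD : a |: K \in D) (BD : b |: K \in D).

Let Dc := [set ~: S | S in D].

Lemma opp_white c : white_nbr (opp_pos f a) (opp_core K a b) b Dc c -> black_nbr f K a b D c.
Proof.
case/and3P; rewrite opp_pos_gt // !inE negbK => /andP[bc ca] /or3P[/eqP eq|/eqP eq|cK].
- by rewrite eq ltnn in ca.
- by rewrite eq ltnn in bc.
case/imsetP=> S SD eqS; apply/and3P; split=> //.
by rewrite (_ : _ :\ c = S) // -[RHS]setCK -eqS; apply/setP=> i; rewrite !inE negb_or negbK.
Qed.

Lemma opp_black c : black_nbr (opp_pos f a) (opp_core K a b) b a Dc c -> white_nbr f K a D c.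
Proof.
case/and3P; rewrite opp_pos_lt // => ac; rewrite !inE !negb_or => /and3P[ca cb cK].
case/imsetP=> S SD eqS; apply/and3P; split=> //.
  by rewrite ltn_neqAle ac (inj_eq val_inj) (inj_eq f_dih.1) eq_sym ca.
rewrite (_ : c |: K = S) // -[S]setCK -eqS; apply/setP=> i; rewrite !inE.
case: (i == c) => //=; have [->|_] := altP (i =P a); first by rewrite (negPf aK) orbT.
have [->|_] := altP (i =P b); first by rewrite (negPf bK).
by case: (i \in K).
Qed.

(** Take the branching prefix at [a] with the size of [K] below [a]. If it
    omits [b] it equals that of [K], and the member without [a] agrees with [K]
    before [a], which yields a white triangle. If it contains [b], the member
    with [a] agrees with [K] after [a]; its complement then yields a black
    triangle. *)
Lemma edge_completion_right : (exists2 c, f a < f c & c \notin K) ->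
  (exists c, white_nbr f K a D c) \/ (exists c, black_nbr f K a b D c).
Proof.
case=> c0 ac0 c0K; have [le_kn Dk Dws cardD] := D_max.
have ba := edge_lt f_dih fb0 ab.
have cardK : k = #|K|.+1 by rewrite -(max_ws_card D_max AD) cardsU1 aK.
have cardK2 := card_split_at f_dih a K; rewrite (negPf aK) in cardK2.
have lt_p : #|above f a K| < n - (f a).+1.
  rewrite -(card_pos_gt f_dih); apply: proper_card; apply/properP; split.
    by apply/subsetP=> i; rewrite !inE => /andP[].
  by exists c0; rewrite !inE ?(negPf c0K).
have le_ja : #|below f a K| <= f a.
  rewrite -[leqRHS](card_pos_lt f_dih) ?subset_leq_card 1?ltnW //.
  by apply/subsetP=> i; rewrite !inE => /andP[].
have lt_jk : #|below f a K| < k by move: cardK cardK2; clear; lia.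
have lt_kn : k + f a < n + #|below f a K| by move: cardK cardK2 lt_p; clear; lia.
have [S [S' [SD S'D aS aS' [cardS eqSS']]]] :=
  branching_exists f_dih Dk Dws le_kn cardD lt_jk le_ja lt_kn.
have cardS2 := card_split_at f_dih a S; rewrite aS cardS (max_ws_card D_max SD) in cardS2.
have neqf x y : x != y -> (f x : nat) != f y by rewrite (inj_eq val_inj) (inj_eq f_dih.1).
have neqin x y (X : {set 'I_n}) : x \in X -> y \notin X -> x != y.
  by move=> xX; apply: contraNneq => <-.
have aA : a \in a |: K by rewrite setU11.
have bB : b \in b |: K by rewrite setU11.
have inA x : x \in K -> x \in a |: K by rewrite !inE orbC => ->.
have inB x : x \in K -> x \in b |: K by rewrite !inE orbC => ->.
have outA x : x != a -> x \notin K -> x \notin a |: K by rewrite !inE negb_or => -> ->.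
have outB x : x != b -> x \notin K -> x \notin b |: K by rewrite !inE negb_or => -> ->.
have aB := outB a ab aK.
have bA : b \notin a |: K by apply: outA; rewrite // eq_sym.
have lt_neq x y : f x < f y -> x != y by apply: contraTneq => ->; rewrite ltnn.
have lt_neq' x y : f x < f y -> y != x by move/lt_neq; rewrite eq_sym.
have gt_b x : x != b -> f b < f x.
  by move=> xb; rewrite fb0 lt0n; have := neqf _ _ xb; rewrite fb0.
have cross := max_ws_cross f_dih D_max.
have [bS|bS] := boolP (b \in S); last first.
  left; suff eqb : below f a S = below f a K.
    have [|c ac [cK cD]] := white_nbr_of_agreement f_dih D_max fb0 ab aK bK AD BD S'D aS'.
      by move=> i ia; rewrite -eqSS' //; move/setP/(_ i): eqb; rewrite !inE ia !andbT.
    by exists c; apply/and3P.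
  apply/eqP/negPn/negP => neqb.
  have [z za [zS zK]] := below_diff cardS neqb.
  have [w wa [wK wS]] : exists2 t, f t < f a & t \in K /\ t \notin S.
    by apply: below_diff; rewrite // eq_sym.
  have := neqf _ _ (neqin _ _ _ zS wS); rewrite neq_ltn => /orP[zw|wz].
    have zb := neqin _ _ _ zS bS.
    exact: (cross _ _ b z w a BD SD (gt_b z zb) zw wa bB bS zS (outB z zb zK) (inB w wK) wS aS aB).
  have cardS'2 := card_split_at f_dih a S'.
  rewrite (negPf aS') (max_ws_card D_max S'D) (_ : below f a S' = below f a S) ?cardS in cardS'2; last first.
    by apply/setP=> i; rewrite !inE; case: (ltnP (f i)) => [/eqSS' ->|]; rewrite ?andbF.
  have [|t at_ [tS' tK]] := @above_diff n f a K S'; first by move: cardS'2 cardK cardK2; clear; lia.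
  rewrite eqSS' // in zS; rewrite eqSS' // in wS.
  exact: (cross _ _ w z a t AD S'D wz za at_ (inA w wK) wS zS (outA z (lt_neq _ _ za) zK)
    aA aS' tS' (outA t (lt_neq' _ _ at_) tK)).
have [|u ua [uK uS]] := @below_diff n f a K S (esym cardS).
  by apply/negP => /eqP/setP/(_ b); rewrite !inE ba bS (negPf bK).
have ub := neqin _ _ _ uK bK.
have eqa : above f a S = above f a K.
  apply/eqP/negPn/negP => neqa.
  have cardeq : #|above f a S| = #|above f a K| by move: cardS2 cardK cardK2; clear; lia.
  have [x] := neq_card_diff (esym cardeq) (contraNN (fun h => introT eqP (esym (eqP h))) neqa).
  rewrite !inE => /andP[xK ax]; rewrite ax andbT => xS.
  have [y] := neq_card_diff cardeq neqa.
  rewrite !inE => /andP[yS ay]; rewrite ay andbT => yK.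
  have := neqf _ _ (neqin _ _ _ xK yK); rewrite neq_ltn => /orP[xy|yx].
    exact: (cross _ _ u a x y BD SD ua ax xy (inB u uK) uS aS aB (inB x xK) xS
      yS (outB y (lt_neq' _ _ (ltn_trans ba ay)) yK)).
  exact: (cross _ _ b u y x SD AD (gt_b u ub) (ltn_trans ua ay) yx bS bA (inA u uK) uS
    yS (outA y (lt_neq' _ _ ay) yK) (inA x xK) xS).
right; have Dc_max := max_ws_compl D_max.
have [||||||||i|c bc [cK cD]] :=
  @white_nbr_of_agreement n (n - k) (opp_pos f a) Dc (opp_core K a b) (~: S) b a (opp_pos_dih a f_dih) Dc_max.
- by rewrite (opp_posE f_dih fb0 ab) ltnn subnn.
- by rewrite eq_sym.
- by rewrite !inE eqxx orbT.
- by rewrite !inE eqxx.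
- by rewrite opp_core_b //; apply: imset_f.
- by rewrite opp_core_a //; apply: imset_f.
- exact: imset_f.
- by rewrite inE bS.
- rewrite opp_pos_lt // !inE leq_eqVlt => /orP[/eqP/(pos_inj f_dih) <-|ai].
    by rewrite aS eqxx.
  rewrite (negPf (lt_neq' _ _ ai)) (negPf (lt_neq' _ _ (ltn_trans ba ai))) /=.
  by move/setP/(_ i): eqa; rewrite !inE ai !andbT => ->.
by exists c; apply: opp_white; apply/and3P.
Qed.

End EdgeCompletion.

(** An edge of a maximum collection lies on a triangle on its far side, unless
    that side contains nothing to add and nothing to remove; the other side is
    seen by cutting the circle at [a]. This plays the part of the statement that
    the triangles tile a disc. The case with something to remove is the other
    one for the complements. *)
Lemma edge_completion n k (f : 'I_n -> 'I_n) (D : {set {set 'I_n}}) (K : {set 'I_n}) (a b : 'I_n) :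
    dihedral f -> max_ws k D -> f b = 0 :> nat -> a != b -> a \notin K -> b \notin K ->
    a |: K \in D -> b |: K \in D ->
    (exists2 c, f a < f c & c \notin K) \/ (exists2 c, f c < f a & c \in K) ->
  (exists c, white_nbr f K a D c) \/ (exists c, black_nbr f K a b D c).
Proof.
move=> f_dih D_max fb0 ab aK bK AD BD [ex|[c0 ca cK]].
  exact: (edge_completion_right f_dih D_max fb0 ab aK bK AD BD ex).
have [|||||||[c /opp_white cB]|[c /opp_black cB]] :=
  @edge_completion_right n (n - k) (opp_pos f a) [set ~: S | S in D] (opp_core K a b) b a
    (opp_pos_dih a f_dih) (max_ws_compl D_max).
- by rewrite (opp_posE f_dih fb0 ab) ltnn subnn.
- by rewrite eq_sym.
- by rewrite !inE eqxx orbT.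
- by rewrite !inE eqxx.
- by rewrite opp_core_b //; apply: imset_f.
- by rewrite opp_core_a //; apply: imset_f.
- exists c0; last by rewrite !inE cK !orbT.
  rewrite opp_pos_gt // ca fb0 lt0n andbT; apply: contraNneq bK => fc0.
  by rewrite -(_ : c0 = b) //; apply: (pos_inj f_dih); rewrite fc0.
- by right; exists c; apply: cB.
by left; exists c; apply: cB.
Qed.

(** * The strip of triangles through an element *)

(** A circular interval is weakly separated from every set, so the size bound
    forces it to belong to a maximum collection. *)
Lemma initial_segment_mem n k (f : 'I_n -> 'I_n) (D : {set {set 'I_n}}) (S : {set 'I_n}) :
  dihedral f -> max_ws k D -> (forall i, (i \in S) = (f i < k)) -> S \in D.
Proof.
move=> f_dih [le_kn Dk Dws cardD] SE; apply/negPn/negP => SD.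
have wsS T : weakly_separated S T.
  apply: (separated_ws (u := 0) (v := k) f_dih) => i; rewrite !inE SE; first by case/andP.
  by case/andP.
have : #|S |: D| <= k * (n - k) + 1.
  apply: (ws_card_le f_dih) => //.
    rewrite subUset Dk sub1set inE andbT -[X in _ == X](card_pos_lt f_dih le_kn).
    by apply/eqP; congr #|pred_of_set _|; apply/setP=> i; rewrite inE SE.
  move=> T T'; rewrite !inE => /orP[/eqP->|TD] /orP[/eqP->|T'D] //; last exact: Dws.
  exact/ws_sym/wsS.
by rewrite cardsU1 SD cardD add1n ltnn.
Qed.

Definition ext n (D : {set {set 'I_n}}) (K : {set 'I_n}) := [set x | (x \notin K) && (x |: K \in D)].

Section Strip.
Variables (n k : nat) (f : 'I_n -> 'I_n) (D : {set {set 'I_n}}) (b : 'I_n).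
Hypotheses (f_dih : dihedral f) (D_max : max_ws k D) (fb0 : f b = 0 :> nat).
Hypotheses (k_gt0 : 0 < k) (lt_kn : k < n).

Notation state := ({set 'I_n} * 'I_n)%type.

(** The edges whose two ends differ by exchanging [b] for another element; such
    an edge is recorded as the common part and the other element. Crossing the
    triangles one by one orders them in a path from one boundary edge to another. *)
Definition strip := [set s : state | [&& s.2 != b, b \in ext D s.1 & s.2 \in ext D s.1]].

(** A white polygon is crossed along its successive corners, a black one
    likewise in the opposite direction; taking the nearest corner is what makes
    the steps reversible. *)
Definition white_step (s s' : state) := [&& white_nbr f s.1 s.2 D s'.2,
  [forall c, white_nbr f s.1 s.2 D c ==> (f s'.2 <= f c)] & s'.1 == s.1].

Definition black_step (s s' : state) := [&& black_nbr f s.1 s.2 b D s'.2,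
  [forall c, black_nbr f s.1 s.2 b D c ==> (f c <= f s'.2)],
  [forall c, ~~ white_nbr f s.1 s.2 D c] & s'.1 == s.2 |: (s.1 :\ s'.2)].

Definition step (s : state) : state :=
  if [pick s' | white_step s s' || black_step s s'] is Some s' then s' else s.

Lemma pos_gt0 x : x != b -> 0 < f x.
Proof.
move=> xb; rewrite lt0n -fb0 (inj_eq val_inj) (inj_eq f_dih.1) //.
Qed.

Lemma card_core K x : x \in ext D K -> #|K|.+1 = k.
Proof. by rewrite inE => /andP[xK xD]; rewrite -(max_ws_card D_max xD) cardsU1 xK. Qed.

Definition last_core := [set i | n - k < f i].
Definition first_core := [set i | 0 < f i < k].

Variables (a0 a1 : 'I_n).
Hypotheses (fa0 : f a0 = k :> nat) (fa1 : f a1 = n - k :> nat).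

Lemma first_strip : (first_core, a0) \in strip.
Proof.
have a0b : a0 != b by apply: contraTneq k_gt0 => eq; rewrite -fa0 eq fb0.
rewrite !inE /= a0b fa0 fb0 !ltnn andbF /=; apply/andP; split.
  apply: (initial_segment_mem f_dih D_max) => i; rewrite !inE -(inj_eq f_dih.1) -(inj_eq val_inj) /= fb0.
  by move: k_gt0; clear; lia.
apply: (initial_segment_mem (dihedral_comp f_dih (dihedral_shift _ n.-1)) D_max) => i.
rewrite !inE -(inj_eq f_dih.1) -(inj_eq val_inj) /= fa0.
rewrite -[_ %% _]/(nat_of_ord (shift_ord n.-1 (f i))) val_shift modn_small; last by move: lt_kn; clear; lia.
by move: lt_kn k_gt0 (ltn_ord (f i)); clear; case: (ltnP (f i + _) n) => ?; lia.
Qed.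

Lemma last_strip : (last_core, a1) \in strip.
Proof.
have a1b : a1 != b by apply: contraTneq lt_kn => eq; rewrite -subn_gt0 -fa1 eq fb0.
rewrite !inE /= a1b fa1 fb0 !ltnn ltn0 /=; apply/andP; split.
  apply: (initial_segment_mem (dihedral_comp f_dih (dihedral_shift _ k.-1)) D_max) => i.
  rewrite !inE -(inj_eq f_dih.1) -(inj_eq val_inj) /= fb0.
  rewrite -[_ %% _]/(nat_of_ord (shift_ord k.-1 (f i))) val_shift modn_small; last by move: lt_kn; clear; lia.
  by move: lt_kn k_gt0 (ltn_ord (f i)); clear; case: (ltnP (f i + _) n) => ?; lia.
apply: (initial_segment_mem (dihedral_comp f_dih (dihedral_shift _ k)) D_max) => i.
rewrite !inE -(inj_eq f_dih.1) -(inj_eq val_inj) /= fa1.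
rewrite -[_ %% _]/(nat_of_ord (shift_ord k (f i))) val_shift modn_small; last by move: lt_kn; clear; lia.
by move: lt_kn k_gt0 (ltn_ord (f i)); clear; case: (ltnP (f i + _) n) => ?; lia.
Qed.

(** [edge_completion] provides a next edge unless the far side of the edge
    contains nothing to add and nothing to remove, which describes the last edge. *)
Lemma stepP s : s \in strip -> s != (last_core, a1) -> white_step s (step s) || black_step s (step s).
Proof.
case: s => K a; rewrite !inE /= => /and3P[ab /andP[bK BD] /andP[aK AD]] neq.
suff ex : exists s', white_step (K, a) s' || black_step (K, a) s'.
  rewrite /step; case: pickP => // none.
  by case: ex => s' ex; move: (none s'); rewrite ex.
have [c cW|noW] := pickP (fun c => white_nbr f K a D c).
  case: (arg_minnP (P := fun c => white_nbr f K a D c) f cW) => c' cW' min.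
  exists (K, c'); rewrite /white_step /= cW' eqxx andbT; apply/orP; left.
  by apply/forallP=> c2; apply/implyP; apply: min.
have [c cB|noB] := pickP (fun c => black_nbr f K a b D c).
  case: (arg_maxnP (P := fun c => black_nbr f K a b D c) f cB) => c' cB' max.
  exists (a |: (K :\ c'), c'); rewrite /black_step /= cB' eqxx andbT /=; apply/orP; right.
  apply/andP; split; apply/forallP=> c2; last by rewrite noW.
  by apply/implyP; apply: max.
case/negP: neq; have full c : (c \in K) = (f a < f c).
  apply/idP/idP => [cK|ac].
    rewrite ltnNge; apply/negP; rewrite leq_eqVlt => /orP[/eqP/(pos_inj f_dih) eq|ca].
      by rewrite eq (negPf aK) in cK.
    have [|[c' cW]|[c' cB]] := edge_completion f_dih D_max fb0 ab aK bK AD BD.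
    - by right; exists c.
    - by rewrite noW in cW.
    - by rewrite noB in cB.
  apply/negPn/negP => cK.
  have [|[c' cW]|[c' cB]] := edge_completion f_dih D_max fb0 ab aK bK AD BD.
  - by left; exists c.
  - by rewrite noW in cW.
  - by rewrite noB in cB.
have KE : K = [set i | f a < f i] by apply/setP=> i; rewrite inE full.
have cardK : #|K|.+1 = k by apply: (@card_core K a); rewrite inE aK.
rewrite KE card_pos_gt // in cardK.
have fak : f a = n - k :> nat by move: cardK (ltn_ord (f a)); clear; lia.
rewrite -(pos_inj f_dih (etrans fak (esym fa1))) xpair_eqE eqxx andbT.
by apply/eqP/setP=> i; rewrite inE full fak.
Qed.

Lemma step_strip s : s \in strip -> s != (last_core, a1) -> step s \in strip.
Proof.
move=> sS s_last; have := stepP sS s_last; move: (step s) => [K' c].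
case: s sS {s_last} => K a; rewrite inE /= => /and3P[ab]; rewrite !inE => /andP[bK BD] /andP[aK AD].
case/orP=> [/and3P[/and3P[/= ac cK CD] _ /eqP /= ->]|].
  rewrite bK BD cK CD /= andbT.
  by apply: contraTneq ac => ->; rewrite fb0 ltn0.
case/and4P=> /and3P[/= ca cK CD] _ _ /eqP /= ->.
have cb : c != b by apply: contraNneq bK => <-.
have ca' : c != a by apply: contraNneq aK => <-.
rewrite cb !inE (negPf bK) eqxx /= andbF orbF eq_sym ab (negPf ca') /=.
apply/andP; split.
  suff <- : (a |: (b |: K)) :\ c = b |: (a |: K :\ c) by [].
  apply/setP=> i; rewrite !inE; case: (altP (i =P c)) => [->|_] //=; first by rewrite (negPf cb) (negPf ca').
  by rewrite orbCA.
suff <- : a |: K = c |: (a |: K :\ c) by [].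
by apply/setP=> i; rewrite !inE; case: (altP (i =P c)) => [->|_] //=; rewrite cK orbT.
Qed.

Lemma step_first s : s \in strip -> s != (last_core, a1) -> step s != (first_core, a0).
Proof.
move=> sS s_last; have := stepP sS s_last; move: (step s) => [K' c].
case: s sS {s_last} => K a; rewrite inE /= => /and3P[ab]; rewrite !inE => /andP[bK BD] /andP[aK AD].
move=> st; apply/negP; rewrite xpair_eqE => /andP[/eqP eK /eqP ec]; subst K' c.
case/orP: st => [/and3P[/and3P[/= ac _ _] _ /eqP /= eqK]|].
  by case/negP: aK; rewrite -eqK inE pos_gt0 // -fa0.
case/and4P=> /and3P[/= ca _ _] _ _ /eqP /= eqK.
have : a \in first_core by rewrite eqK setU11.
by rewrite inE pos_gt0 //= -fa0 ltnNge ltnW.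
Qed.

(** An edge cannot be entered through a white and through a black triangle: the
    third corners of the two triangles would cross. *)
Lemma step_mixed s1 s2 s' : s1 \in strip -> s2 \in strip ->
  white_step s1 s' -> black_step s2 s' -> False.
Proof.
case: s1 s2 s' => [K1 a] [K2 e] [K c].
rewrite !inE /= => /and3P[ab /andP[bK1 BD1] /andP[aK1 AD1]] /and3P[eb /andP[bK2 BD2] /andP[eK2 ED2]].
case/and3P=> /and3P[/= ac cK CD] _ /eqP /= eqK; subst K1.
case/and4P=> /and3P[/= ce cK2 _] _ _ /eqP /= eqK.
have ac' : a != c by apply: contraTneq ac => ->; rewrite ltnn.
have ce' : e != c by apply: contraTneq ce => ->; rewrite ltnn.
have cb : c != b by apply: contraTneq ac => ->; rewrite fb0 ltn0.
have eK : e \in K by rewrite eqK setU11.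
have ae : a != e by apply: contraNneq aK1 => ->.
have aK2 : a \notin K2 by move: aK1; rewrite eqK !inE (negPf ae) ac'.
apply: (@max_ws_cross n k f f_dih D D_max (b |: K2) (a |: K) b a c e) => //.
- by rewrite fb0 pos_gt0.
- by rewrite setU11.
- by rewrite !inE eq_sym (negPf ab).
- by rewrite setU11.
- by rewrite !inE (negPf ab).
- by rewrite !inE cK2 orbT.
- by rewrite !inE eq_sym (negPf ac').
- by rewrite !inE eK orbT.
- by rewrite !inE (negPf eb).
Qed.

Lemma step_inj : {in strip :\ (last_core, a1) &, injective step}.
Proof.
have white_le s1 s2 s' : s1 \in strip -> s2 \in strip -> white_step s1 s' -> white_step s2 s' ->
    f s2.2 <= f s1.2.
  case: s1 s2 s' => [K1 x1] [K2 x2] [K c]; rewrite !inE /=.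
  move=> _ /and3P[_ _ /andP[x2K x2D]].
  case/and3P=> _ /forallP /= min1 /eqP /= e1 /and3P[/and3P[/= lt2 _ _] _ /eqP /= e2]; subst K1 K2.
  rewrite leqNgt; apply/negP => lt; have := min1 x2.
  by rewrite /white_nbr lt x2K x2D /= leqNgt lt2.
have black_le s1 s2 s' : s1 \in strip -> s2 \in strip -> black_step s1 s' -> black_step s2 s' ->
    f s2.2 <= f s1.2.
  case: s1 s2 s' => [K1 x1] [K2 x2] [K c]; rewrite !inE /=.
  move=> /and3P[x1b /andP[bK1 BD1] /andP[x1K1 _]] /and3P[x2b /andP[bK2 _] /andP[x2K2 x2D]].
  case/and4P=> /and3P[/= lt1 cK1 _] _ _ /eqP /= eqK1.
  case/and4P=> /and3P[/= lt2 cK2 _] /forallP /= max2 _ /eqP /= eqK2.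
  rewrite leqNgt; apply/negP => lt.
  have neq : x1 != x2 by apply: contraTneq lt => ->; rewrite ltnn.
  have eqM : x1 |: K1 = x2 |: K2.
    have E x (X : {set 'I_n}) : c \in X -> x |: X = c |: (x |: X :\ c).
      by move=> cX; apply/setP=> i; rewrite !inE; case: (altP (i =P c)) => [->|_] //=; rewrite cX orbT.
    by rewrite (E x1) // (E x2) // -eqK1 -eqK2.
  have x1K2 : x1 \in K2 by have := setU11 x1 K1; rewrite eqM !inE (negPf neq).
  have := max2 x1; rewrite /black_nbr lt x1K2 /=.
  rewrite (_ : _ :\ x1 = b |: K1) ?BD1 /=; first by rewrite leqNgt lt1.
  rewrite setUCA -eqM; apply/setP=> i; rewrite !inE.
  by case: (altP (i =P x1)) => [->|] //=; rewrite (negPf x1b) (negPf x1K1).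
move=> s1 s2; rewrite !in_setD1 => /andP[n1 S1] /andP[n2 S2] eq.
have st1 := stepP S1 n1; have := stepP S2 n2; rewrite -eq => st2.
have same_pos : f s1.2 = f s2.2 :> nat -> s1.1 = s2.1 -> s1 = s2.
  by case: s1 s2 {S1 S2 n1 n2 eq st1 st2} => [? ?] [? ?] /= /(pos_inj f_dih) -> ->.
case/orP: st1 => st1; case/orP: st2 => st2.
- apply: same_pos; first by apply/eqP; rewrite eqn_leq (white_le _ _ _ S2 S1 st2 st1) (white_le _ _ _ S1 S2 st1 st2).
  by case/and3P: st1 => _ _ /eqP <-; case/and3P: st2 => _ _ /eqP.
- by case: (step_mixed S1 S2 st1 st2).
- by case: (step_mixed S2 S1 st2 st1).
have e2 : s1.2 = s2.2.
  by apply/(pos_inj f_dih)/eqP; rewrite eqn_leq (black_le _ _ _ S2 S1 st2 st1) (black_le _ _ _ S1 S2 st1 st2).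
apply: same_pos; first by rewrite e2.
case/and4P: st1 => /and3P[_ c1 _] _ _ /eqP eqK1; case/and4P: st2 => /and3P[_ c2 _] _ _ /eqP eqK2.
have E (s : state) c : s \in strip -> c \in s.1 -> s.1 = c |: ((s.2 |: s.1 :\ c) :\ s.2).
  case: s => K a; rewrite !inE /= => /and3P[_ _ /andP[aK _]] cK; apply/setP=> i; rewrite !inE.
  case: (altP (i =P c)) => [->|] //=; case: (altP (i =P a)) => [->|] //=.
  by rewrite (negPf aK).
by rewrite (E s1 _ S1 c1) (E s2 _ S2 c2) -eqK1 -eqK2 e2.
Qed.

Variable t : nat.

(** Black steps keep the endpoint [s.2 |: s.1] of the edge; a white step moves
    one element of it forward, so the weight grows exactly when a white step
    passes position [t]. *)
Definition weight (s : state) := #|[set i in s.2 |: s.1 | t <= f i]|.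

Definition crossing (s : state) := [&& f s.2 < t, [exists c, white_nbr f s.1 s.2 D c] &
  [forall c, white_nbr f s.1 s.2 D c ==> (t <= f c)]].

Lemma weight_step s : s \in strip -> s != (last_core, a1) ->
  weight (step s) = weight s + crossing s.
Proof.
move=> sS s_last; have := stepP sS s_last; move: (step s) => [K' c].
case: s sS {s_last} => K a; rewrite inE /= => /and3P[ab _]; rewrite inE => /andP[aK _].
have weightE x : x \notin K -> weight (K, x) = (t <= f x) + #|[set i in K | t <= f i]|.
  move=> xK; rewrite /weight /=; case: (leqP t (f x)) => tx.
    have := cardsU1 x [set i in K | t <= f i]; rewrite inE (negPf xK) /= => <-.
    by congr #|pred_of_set _|; apply/setP=> i; rewrite !inE; case: (altP (i =P x)) => [->|].
  rewrite add0n; congr #|pred_of_set _|; apply/setP=> i; rewrite !inE.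
  case: (altP (i =P x)) => [->|] //.
  by rewrite leqNgt tx !andbF.
case/orP=> [/and3P[/= cW /forallP min /eqP /= ->]|].
  have /and3P[ac cK _] := cW; rewrite !weightE // /crossing /=.
  have -> : [exists c, white_nbr f K a D c] by apply/existsP; exists c.
  have -> : [forall c, white_nbr f K a D c ==> (t <= f c)] = (t <= f c).
    apply/forallP/idP => [/(_ c)|tc c2]; first by rewrite cW.
    by apply/implyP => /(implyP (min c2)); apply: leq_trans.
  by move: ac; clear; case: (leqP t (f a)) => ?; case: (leqP t (f c)) => ?; lia.
case/and4P=> /and3P[/= ca cK _] _ /forallP noW /eqP /= ->.
rewrite /crossing /= (_ : [exists c, _] = false) ?andbF ?addn0; last first.
  by apply/existsP => -[c2]; apply/negP.
congr #|pred_of_set _|; apply/setP=> i; rewrite !inE /=.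
by case: (altP (i =P c)) => [->|] //=; rewrite cK orbT.
Qed.

Lemma crossing_last : crossing (last_core, a1) = false.
Proof.
apply/and3P => -[_ /existsP[c /and3P[/= ac]]]; by rewrite inE -fa1 ac.
Qed.

(** [step] is injective on the strip without its last edge and never hits the
    first one, hence is a bijection onto the strip without the first edge, and
    the increments of the weight telescope. *)
Lemma crossing_count :
  weight (last_core, a1) = weight (first_core, a0) + \sum_(s in strip) crossing s.
Proof.
have onto : step @: (strip :\ (last_core, a1)) = strip :\ (first_core, a0).
  apply/eqP; rewrite eqEcard; apply/andP; split.
    apply/subsetP=> _ /imsetP[s + ->]; rewrite !in_setD1 => /andP[neq sS].
    by rewrite step_first ?step_strip.
  rewrite (card_in_imset step_inj).
  have := cardsD1 (last_core, a1) strip; rewrite last_strip.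
  by rewrite (cardsD1 (first_core, a0)) first_strip => /addnI ->.
have eqB : \sum_(s in strip :\ (first_core, a0)) weight s =
    \sum_(s in strip :\ (last_core, a1)) weight s + \sum_(s in strip :\ (last_core, a1)) crossing s.
  rewrite -onto (big_imset _ step_inj) -big_split; apply: eq_bigr => s.
  by rewrite in_setD1 => /andP[neq sS]; apply: weight_step.
have sumD1 (F : state -> nat) s0 : s0 \in strip ->
    \sum_(s in strip) F s = F s0 + \sum_(s in strip :\ s0) F s.
  by move=> s0S; rewrite (big_setD1 s0).
rewrite (sumD1 _ _ last_strip) crossing_last add0n.
have arith u v A B C : u + A = v + B -> B = A + C -> u = v + C by clear; lia.
by apply: arith eqB; rewrite -!sumD1 ?last_strip ?first_strip.
Qed.

(** A white polygon containing [b] is crossed at position [t] at most once,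
    namely from its last corner before [t] to its first corner after [t]. *)
Lemma crossing_core :
  \sum_(s in strip) crossing s =
  #|[set K | [&& b \in ext D K, [exists a in ext D K, 0 < f a < t] &
     [exists c in ext D K, (t <= f c)]]]|.
Proof.
rewrite -big_mkcondr /= sum1dep_card.
rewrite -(card_in_imset (f := fst)); last first.
  move=> [K1 x1] [K2 x2]; rewrite !inE /= => /andP[S1 cr1] /andP[S2 cr2] eqK; subst K2.
  have neq_lt (y1 y2 : 'I_n) : y1 \in ext D K1 -> y2 \in ext D K1 ->
      f y2 < t -> crossing (K1, y1) -> f y2 <= f y1.
    rewrite !inE => _ /andP[y2K y2D] y2t /and3P[_ _ /forallP/(_ y2)] /=.
    by rewrite /white_nbr y2K y2D !andbT (leqNgt t) y2t /= implybF -leqNgt.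
  have /and3P[_ _ /= x1E] := S1; have /and3P[_ _ /= x2E] := S2.
  have /and3P[/= x1t _ _] := cr1; have /and3P[/= x2t _ _] := cr2.
  congr (_, _); apply/(pos_inj f_dih)/eqP; rewrite eqn_leq.
  by apply/andP; split; apply: neq_lt; rewrite // inE.
congr #|pred_of_set _|; apply/setP=> K; rewrite inE; apply/imsetP/and3P.
  case=> -[K' a]; rewrite inE => /andP[]; rewrite inE => /and3P[/= ab bE aE].
  case/and3P=> /= a_t /existsP[c cW] /forallP all ->; split=> //.
    by apply/existsP; exists a; rewrite aE pos_gt0 ?a_t.
  apply/existsP; exists c; rewrite (implyP (all c) cW) andbT inE.
  by case/and3P: cW => _ -> ->.
case=> bE /existsP[a2 /and3P[a2E a2_gt0 a2t]] /existsP[c /andP[cE tc]].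
have := arg_maxnP (P := fun a => (a \in ext D K) && (f a < t)) f (i0 := a2).
rewrite a2E a2t => /(_ isT) [a /andP[aE a_t] max].
have a_gt0 : 0 < f a by apply: leq_trans a2_gt0 (max _ _); rewrite a2E.
exists (K, a) => //; rewrite !inE /= in bE aE cE *; rewrite aE bE.
rewrite (contraTneq _ a_gt0) /= => [|->]; last by rewrite fb0.
apply/and3P; split=> //.
  apply/existsP; exists c; apply/and3P; case/andP: cE => cK cD; split=> //=.
  exact: leq_trans a_t tc.
apply/forallP=> c2; apply/implyP => /and3P[/= ac2 c2K c2D].
rewrite leqNgt; apply: contraTN ac2 => c2t; rewrite -leqNgt.
by apply: max; rewrite inE c2K c2D.
Qed.

End Strip.

(** * The number of white triangles *)

Lemma card_ord_range n u v : v <= n -> #|[set i : 'I_n | u <= i < v]| = v - u.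
Proof.
move=> le_vn; have := cardsID [set i : 'I_n | i < u] [set i : 'I_n | i < v].
rewrite (card_pos_lt (dihedral_id n) le_vn).
have -> : [set i : 'I_n | i < v] :\: [set i : 'I_n | i < u] = [set i : 'I_n | u <= i < v].
  by apply/setP=> i; rewrite !inE -leqNgt.
have -> : [set i : 'I_n | i < v] :&: [set i : 'I_n | i < u] = [set i : 'I_n | i < minn u v].
  by apply/setP=> i; rewrite !inE leq_min andbC.
rewrite (card_pos_lt (dihedral_id n)) ?geq_min ?le_vn ?orbT //.
by clear; lia.
Qed.

(** The corners of [W] that are neither first nor last; for a polygon they count
    the triangles of a triangulation, independently of where the circle is cut. *)
Definition inner n (W : {set 'I_n}) :=
  [set b in W | [exists a in W, b < a] && [exists c in W, c < b]].

Lemma card_inner n (W : {set 'I_n}) : #|inner W| = #|W| - 2.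
Proof.
have [->|[w0 w0W]] := set_0Vmem W.
  by rewrite cards0 (_ : inner _ = set0) ?cards0 //; apply/setP=> i; rewrite !inE.
have := arg_minnP (P := fun i => i \in W) (@nat_of_ord n) w0W => -[m mW minm].
have := arg_maxnP (P := fun i => i \in W) (@nat_of_ord n) w0W => -[M MW maxM'].
have maxM i : i \in W -> i <= M := maxM' i.
have -> : inner W = (W :\ m) :\ M.
  apply/setP=> b; rewrite !inE [RHS]andbA [RHS]andbC.
  apply: andb_id2l => bW; congr (_ && _); last first.
    apply/existsP/idP => [[c /andP[cW cb]]|bM].
      by apply: contraTneq cb => ->; rewrite -leqNgt minm.
    by exists m; rewrite mW ltn_neqAle minm // andbT eq_sym.
  apply/existsP/idP => [[c /andP[cW cb]]|bM].
    by apply: contraTneq cb => ->; rewrite -leqNgt maxM.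
  by exists M; rewrite MW ltn_neqAle maxM // andbT.
have := cardsD1 m W; have := cardsD1 M (W :\ m); rewrite mW !inE MW andbT.
have [eqMm|] := eqVneq M m; last by move=> _; clear; lia.
have -> : W :\ m :\ M = set0; last by rewrite cards0; clear; lia.
apply/setP=> b; rewrite !inE eqMm; apply/negP => /and3P[_ bm bW]; case/negP: bm.
by rewrite -(inj_eq val_inj) eqn_leq minm // -eqMm maxM.
Qed.

Lemma sum_minn_sub n k : k < n ->
  \sum_(b < n) minn b k = \sum_(b < n) (b + k + 1 - n) + k * (n - k - 1).
Proof.
move=> lt_kn; have le_kn := ltnW lt_kn; rewrite [X in _ = X + _](reindex_inj rev_ord_inj) /=.
have -> : \sum_(b < n) minn b k = n * k - \sum_(b < n) (k - b).
  have -> : n * k = \sum_(b < n) (minn b k + (k - b)).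
    rewrite (eq_bigr (fun=> k)) ?sum_nat_const ?card_ord // => b _.
    by clear; lia.
  by rewrite big_split addnK.
have -> : \sum_(b < n) (n - b.+1 + k + 1 - n) = \sum_(b < n) (k - b).
  by apply: eq_bigr => b _; move: (ltn_ord b); clear; lia.
have : 2 * \sum_(b < n) (k - b) = k * k.+1.
  have gauss m : m <= k -> 2 * \sum_(b < m) (k - b) + (k - m) * (k - m).+1 = k * k.+1.
    elim: m => [|m IHm] lt_mk; first by rewrite big_ord0; clear; lia.
    by rewrite -IHm ?big_ord_recr /=; [move: lt_mk; clear; nia|exact: ltnW].
  have : \sum_(b < n) (k - b) = \sum_(b < k) (k - b).
    rewrite (big_ord_widen n (fun b => k - b) le_kn) [RHS]big_mkcond.
    by apply: eq_bigr => b _; case: ltnP => //; rewrite -subn_eq0 => /eqP.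
  by move->; rewrite -(gauss k) ?subnn ?addn0.
move: (\sum_(b < n) (k - b)) => S; rewrite -(subnKC lt_kn); move: (n - k.+1) => m; clear.
have -> : k.+1 + m - k - 1 = m by lia.
by rewrite mulnDl [k.+1 * k]mulnC [m * k]mulnC => <-; lia.
Qed.

Lemma rotation_to n (b : 'I_n) : exists2 f : 'I_n -> 'I_n, dihedral f &
  forall i : 'I_n, f i = (if i < b then i + n - b else i - b) :> nat.
Proof.
exists (@shift_ord n (n - b)) => [|i]; first exact: dihedral_shift.
rewrite val_shift; move: (ltn_ord i) (ltn_ord b); clear.
case: (posnP b) => [->|b_gt0] ? ?.
  by rewrite subn0 modnn addn0 ltn0 subn0; case: (ltnP i n) => ?; lia.
rewrite modn_small; last by lia.
by case: (ltnP (i + _)) => ?; case: (ltnP i b) => ?; lia.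
Qed.

(** A triangle in a fan triangulation of a white polygon is recorded by its
    middle corner [b]. Cut at [b], the wrap-around point of the original order
    sits at position [n - b], so the triangles with middle corner [b] are the
    crossings of that position along the strip of [b], and the weights of the two
    boundary edges are explicit. *)
Lemma sum_ext n k (D : {set {set 'I_n}}) : max_ws k D -> 0 < k -> k < n ->
  \sum_(K : {set 'I_n}) (#|ext D K| - 2) = k * (n - k - 1).
Proof.
move=> D_max k_gt0 lt_kn.
under eq_bigr do rewrite -card_inner -sum1_card big_mkcond.
rewrite exchange_big /=.
have count (b : 'I_n) : minn b k = b + k + 1 - n + \sum_(K : {set 'I_n}) (if b \in inner (ext D K) then 1 else 0).
  have [f f_dih fE] := rotation_to b.
  have fb0 : f b = 0 :> nat by rewrite fE ltnn subnn.
  have [a0 fa0] := surj_pos f_dih lt_kn.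
  have [a1 fa1] : exists y, f y = n - k :> nat by apply: (surj_pos f_dih); move: lt_kn k_gt0; clear; lia.
  have := crossing_count f_dih D_max fb0 k_gt0 lt_kn fa0 fa1 (n - b).
  rewrite (crossing_core D f_dih fb0).
  have -> : weight f (n - b) (last_core k f, a1) = minn b k.
    rewrite -[RHS](_ : #|[set i : 'I_n | b - k <= i < b]| = minn b k).
      congr #|pred_of_set _|; apply/setP=> i; rewrite !inE -(inj_eq f_dih.1) -(inj_eq val_inj) /= fa1 !fE.
      by move: (ltn_ord i) (ltn_ord b) lt_kn; clear; case: (ltnP i b) => ?; lia.
    by rewrite card_ord_range 1?ltnW //; clear; lia.
  have -> : weight f (n - b) (first_core k f, a0) = b + k + 1 - n.
    rewrite -[RHS](_ : #|[set i : 'I_n | 0 <= i < b + k + 1 - n]| = _).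
      congr #|pred_of_set _|; apply/setP=> i; rewrite !inE -(inj_eq f_dih.1) -(inj_eq val_inj) /= fa0 !fE.
      by move: (ltn_ord i) (ltn_ord b) lt_kn; clear; case: (ltnP i b) => ?; lia.
    by rewrite card_ord_range ?subn0 //; move: (ltn_ord b) lt_kn; clear; lia.
  move=> ->; congr (_ + _); rewrite -big_mkcond /= sum1dep_card.
  congr #|pred_of_set _|; apply/setP=> K; rewrite !inE; congr (_ && _).
  congr (_ && _); apply: eq_existsb => c; congr (_ && _); rewrite fE;
    by move: (ltn_ord c) (ltn_ord b); clear; case: (ltnP c b) => ?; lia.
have := sum_minn_sub lt_kn; rewrite (eq_bigr _ (fun b _ => count b)) big_split /=.
by move/addnI.
Qed.

(** * Free and fixed orbits of the rotation *)

Lemma order_eq (T : finType) (f : T -> T) x d : injective f -> 0 < d -> iter d f x = x ->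
  (forall j, 0 < j < d -> iter j f x != x) -> order f x = d.
Proof.
move=> f_inj d_gt0 fd noj; case: (ltngtP (order f x) d) => // lt.
  by have := noj (order f x); rewrite order_gt0 lt iter_order // eqxx => /(_ isT).
by have := findex_iter lt; rewrite fd findex0 => eq0; rewrite -eq0 in d_gt0.
Qed.

Lemma inj_closed_inv (T : finType) (f : T -> T) (A : {pred T}) : injective f ->
  {in A, forall x, f x \in A} -> forall x, (f x \in A) = (x \in A).
Proof.
move=> f_inj fA x; apply/idP/idP => [fxA|]; last exact: fA.
rewrite -[x](iter_order f_inj) -(prednK (order_gt0 f x)) iterSr.
by elim: (order f x).-1 => //= m IHm; apply: fA.
Qed.

Lemma card_orbits_dvd (T : finType) (f : T -> T) (A : {set T}) d : injective f ->
  {in A, forall x, f x \in A} -> {in A, forall x, order f x = d} -> d %| #|A|.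
Proof.
move=> f_inj fA ordA; rewrite -(@fcard_order_set _ _ f_inj d (mem A)) ?dvdn_mull //.
  by apply/subsetP=> x xA; rewrite inE; apply/eqP; apply: ordA.
by apply: intro_closed => [|x y /eqP <-]; [exact: fconnect_sym|exact: fA].
Qed.

Section Rotation.
Variables (n l : nat).
Hypotheses (n_gt0 : 0 < n).

Let d := n %/ gcdn n l.

Lemma period_gt0 : 0 < d.
Proof. by rewrite divn_gt0 ?gcdn_gt0 ?n_gt0 // dvdn_leq ?dvdn_gcdl. Qed.

Lemma dvdn_period j : (n %| j * l) = (d %| j).
Proof.
have g_gt0 : 0 < gcdn n l by rewrite gcdn_gt0 n_gt0.
have n_classes : n = d * gcdn n l by rewrite divnK ?dvdn_gcdl.
have lE : l = l %/ gcdn n l * gcdn n l by rewrite divnK ?dvdn_gcdr.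
have cop : coprime d (l %/ gcdn n l).
  rewrite /coprime -(eqn_pmul2r g_gt0) mul1n.
  by rewrite muln_gcdl -n_classes -lE.
by rewrite [X in X %| _]n_classes [X in _ %| _ * X]lE mulnA dvdn_pmul2r // Gauss_dvdl.
Qed.

Lemma shift_ordD s t (i : 'I_n) : shift_ord s (shift_ord t i) = shift_ord (t + s) i.
Proof. by apply: val_inj; rewrite /= modnDml addnA. Qed.

Lemma iter_shift_ord j (i : 'I_n) : iter j (shift_ord l) i = shift_ord (j * l) i.
Proof.
elim: j => [|j IHj]; last by rewrite iterS IHj shift_ordD mulSn addnC.
by apply: val_inj; rewrite /= addn0 modn_small.
Qed.

Lemma shift_ord_fix t (i : 'I_n) : (shift_ord t i == i) = (n %| t).
Proof.
rewrite -(inj_eq val_inj) /= -[X in _ == X](modn_small (ltn_ord i)).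
by rewrite -{2}[i : nat]addn0 eqn_modDl mod0n.
Qed.

Lemma order_shift_ord (i : 'I_n) : order (@shift_ord n l) i = d.
Proof.
apply: order_eq; first exact: (dihedral_shift n l).1.
- exact: period_gt0.
- by rewrite iter_shift_ord; apply/eqP; rewrite shift_ord_fix dvdn_period.
move=> j /andP[j_gt0 lt_jd]; rewrite iter_shift_ord shift_ord_fix dvdn_period.
by rewrite gtnNdvd.
Qed.

Lemma shift_set_inj t : injective (@shift_set n t).
Proof. exact/imset_inj/(dihedral_shift n t).1. Qed.

Lemma mem_shift_set t (S : {set 'I_n}) i : (shift_ord t i \in shift_set t S) = (i \in S).
Proof. by rewrite mem_imset //; apply: (dihedral_shift n t).1. Qed.

Lemma iter_shift_set j (S : {set 'I_n}) : iter j (shift_set l) S = shift_set (j * l) S.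
Proof.
elim: j => [|j IHj].
  rewrite /shift_set (eq_imset (g := id)) ?imset_id // => i.
  by apply: val_inj; rewrite /= addn0 modn_small.
rewrite iterS IHj /shift_set -imset_comp; apply: eq_imset => i.
by rewrite /= shift_ordD mulSn addnC.
Qed.

Lemma shift_set_fixed_card (S : {set 'I_n}) : shift_set l S = S -> d %| #|S|.
Proof.
move=> fixS; apply: card_orbits_dvd (dihedral_shift n l).1 _ _ => i iS.
  by rewrite -fixS mem_shift_set.
exact: order_shift_ord.
Qed.

End Rotation.

Lemma shift_set_periodic n t (S : {set 'I_n}) (x y : 'I_n) : shift_set t S = S ->
  x = y %[mod gcdn n t] -> x \in S -> y \in S.
Proof.
move=> fixS eqxy xS; have n_gt0 : 0 < n by apply: leq_ltn_trans (ltn_ord x).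
have [a _ dvd_a] := Bezoutl t n_gt0.
have le_y : y <= x + n by rewrite (leq_trans (ltnW (ltn_ord y))) ?leq_addl.
have /dvdnP[c eqc] : gcdn n t %| x + n - y.
  rewrite -eqn_mod_dvd //; have /dvdnP[q {2}->] := dvdn_gcdl n t.
  by rewrite addnC modnMDl eqxy.
have -> : y = iter (a * c) (shift_ord t) x.
  rewrite iter_shift_ord; apply: val_inj; rewrite /= -[LHS](modn_small (ltn_ord y)).
  apply/eqP; rewrite -(eqn_modDl (x + n - y)) subnK //.
  have -> : x + n - y + (x + a * c * t) = x + c * (gcdn n t + a * t) by rewrite eqc; lia.
  by rewrite modnDr -modnDmr -modnMmr (eqP dvd_a) muln0 mod0n addn0.
elim: (a * c) => //= m IHm; by rewrite -fixS mem_shift_set.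
Qed.

Section Necessity.
Variables (n k l : nat) (D : {set {set 'I_n}}).
Hypotheses (D_max : max_ws k D) (D_rho : rho_symmetric l D).
Hypotheses (k_gt0 : 0 < k) (lt_kn : k < n).

Let n_gt0 : 0 < n. Proof. exact: leq_ltn_trans lt_kn. Qed.
Let d := n %/ gcdn n l.
Let rho := @shift_set n l.

Lemma rho_mem S : (rho S \in D) = (S \in D).
Proof. exact: (@inj_closed_inv _ rho (mem D) (@shift_set_inj n l) D_rho). Qed.

Lemma rho_ext K : ext D (rho K) = rho (ext D K).
Proof.
have shift_inj := (dihedral_shift n l).1.
have eq1 i : (shift_ord l i \in ext D (rho K)) = (i \in ext D K).
  rewrite !inE mem_shift_set; congr (~~ _ && _); rewrite -[RHS]rho_mem.
  by rewrite /rho /shift_set imsetU1.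
apply/setP=> i; have [h hK shiftK] := injF_bij shift_inj.
by rewrite -[i]shiftK eq1 mem_shift_set.
Qed.

(** Two different sets of the same size that are both invariant under a proper
    rotation interlace: an element of each difference and their translates
    alternate around the circle. *)
Lemma periodic_interlaced (K K' : {set 'I_n}) h : h %| n -> h < n ->
  (forall x y : 'I_n, x = y %[mod h] -> x \in K -> y \in K) ->
  (forall x y : 'I_n, x = y %[mod h] -> x \in K' -> y \in K') ->
  #|K| = #|K'| -> K != K' ->
  exists a b c e : 'I_n, [/\ a < b, b < c & c < e] /\
   ([/\ a \in K :\: K', c \in K :\: K', b \in K' :\: K & e \in K' :\: K] \/
    [/\ a \in K' :\: K, c \in K' :\: K, b \in K :\: K' & e \in K :\: K']).
Proof.
move=> h_n lt_hn perK perK' eqKK' neqKK'.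
have h_gt0 : 0 < h by apply: dvdn_gt0 h_n.
have le_2hn : h + h <= n.
  case/dvdnP: h_n lt_hn => q ->; case: q => [|[|q]]; rewrite ?mul1n ?ltnn // => _.
  by rewrite !mulSn addnA leq_addr.
have per (P P' : {set 'I_n}) (x y : 'I_n) :
    (forall x y : 'I_n, x = y %[mod h] -> x \in P -> y \in P) ->
    (forall x y : 'I_n, x = y %[mod h] -> x \in P' -> y \in P') ->
    x = y %[mod h] -> x \in P :\: P' -> y \in P :\: P'.
  move=> pP pP' xy; rewrite !inE => /andP[xP' xP]; rewrite (pP x) // andbT.
  by apply: contraNN xP'; apply: pP'.
have [u uK uK'] := neq_card_diff eqKK' neqKK'.
have [v vK' vK] : exists2 x, x \in K' & x \notin K by apply: neq_card_diff; rewrite // eq_sym.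
have uD : u \in K :\: K' by rewrite inE uK uK'.
have vD : v \in K' :\: K by rewrite inE vK vK'.
have lt_u : u %% h < h by rewrite ltn_mod.
have lt_v : v %% h < h by rewrite ltn_mod.
have Hu0 : u %% h < n by apply: ltn_trans lt_hn.
have Hv0 : v %% h < n by apply: ltn_trans lt_hn.
have Hu1 : u %% h + h < n by apply: leq_trans le_2hn; rewrite ltn_add2r.
have Hv1 : v %% h + h < n by apply: leq_trans le_2hn; rewrite ltn_add2r.
have u0D : Ordinal Hu0 \in K :\: K' by apply: (per _ _ u) uD => //=; rewrite modn_mod.
have u1D : Ordinal Hu1 \in K :\: K' by apply: (per _ _ u) uD => //=; rewrite modnDr modn_mod.
have v0D : Ordinal Hv0 \in K' :\: K by apply: (per _ _ v) vD => //=; rewrite modn_mod.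
have v1D : Ordinal Hv1 \in K' :\: K by apply: (per _ _ v) vD => //=; rewrite modnDr modn_mod.
have : u %% h != v %% h.
  apply: contraTneq uD => eq_uv; have := per _ _ v u perK' perK (esym eq_uv) vD.
  by rewrite !inE => /andP[/negPf -> _]; rewrite andbF.
rewrite neq_ltn => /orP[lt|lt].
  exists (Ordinal Hu0), (Ordinal Hv0), (Ordinal Hu1), (Ordinal Hv1); split; last by left.
  by split; rewrite /= ?ltn_add2r //; move: lt_v; clear; lia.
exists (Ordinal Hv0), (Ordinal Hu0), (Ordinal Hv1), (Ordinal Hu1); split; last by right.
by split; rewrite /= ?ltn_add2r //; move: lt_u; clear; lia.
Qed.

Lemma fixed_period K j : 0 < j < d -> iter j rho K = K ->
  exists h, [/\ h %| n, h < n, forall x y : 'I_n, x = y %[mod h] -> x \in K -> y \in K &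
    forall x y : 'I_n, x = y %[mod h] -> x \in rho K -> y \in rho K].
Proof.
move=> /andP[j_gt0 lt_jd] fixK; exists (gcdn n (j * l)).
have fixK2 : shift_set (j * l) K = K by rewrite -iter_shift_set.
split; first exact: dvdn_gcdl.
- rewrite ltn_neqAle dvdn_leq ?dvdn_gcdl // andbT; apply: contraTneq lt_jd => eqn_.
  have : n %| j * l by rewrite -{1}eqn_ dvdn_gcdr.
  by rewrite dvdn_period // => /(dvdn_leq j_gt0); rewrite -leqNgt.
- by move=> x y; apply: shift_set_periodic.
- move=> x y; apply: shift_set_periodic.
  by rewrite -iter_shift_set -[rho K]/(iter 1 rho K) -iterD addnC iterD fixK.
Qed.

Lemma fixed_mem S j : S \in D -> 0 < j < d -> iter j rho S = S -> rho S = S.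
Proof.
move=> SD jd fixS; apply/eqP/negPn/negP => neq.
have [h [h_n lt_hn per per']] := fixed_period jd fixS.
have rSD : rho S \in D by rewrite rho_mem.
have [_ _ Dws _] := D_max; have := Dws _ _ SD rSD; apply.
have [||a [b [c [e [abc [in1|in2]]]]]] := periodic_interlaced h_n lt_hn per per'.
- by rewrite (max_ws_card D_max SD) (max_ws_card D_max rSD).
- by rewrite eq_sym.
- by left; exists a, b, c, e.
- by right; exists a, b, c, e.
Qed.

Lemma exists_avoiding2 (W : {set 'I_n}) b e : 2 < #|W| -> exists2 x, x \in W & (x != b) && (x != e).
Proof.
move=> W_gt2; have : 0 < #|W :\ b :\ e|.
  have := cardsD1 b W; have := cardsD1 e (W :\ b); move: W_gt2; clear.
  by case: (_ \in _); case: (_ \in _); lia.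
by case/card_gt0P=> x; rewrite !inE => /and3P[xe xb xW]; exists x; rewrite ?xb.
Qed.

(** With at least three corners available, the added elements can be chosen away
    from the four interlaced elements, so that the interlacing of the common
    parts survives in two members of the collection. *)
Lemma fixed_core K j : 2 < #|ext D K| -> 0 < j < d -> iter j rho K = K -> rho K = K.
Proof.
move=> K_gt2 jd fixK; apply/eqP/negPn/negP => neq.
have [h [h_n lt_hn per per']] := fixed_period jd fixK.
have rK_gt2 : 2 < #|ext D (rho K)| by rewrite rho_ext card_imset //; exact: (dihedral_shift n l).1.
have [_ _ Dws _] := D_max.
have use a c b e : a \in K :\: rho K -> c \in K :\: rho K -> b \in rho K :\: K -> e \in rho K :\: K ->
  exists S S', [/\ S \in D, S' \in D, a \in S :\: S', c \in S :\: S' &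
     b \in S' :\: S /\ e \in S' :\: S].
  rewrite !inE => /andP[a1 a2] /andP[c1 c2] /andP[b1 b2] /andP[e1 e2].
  have [x + /andP[xb xe]] := exists_avoiding2 b e K_gt2; rewrite inE => /andP[xK xD].
  have [y + /andP[ya yc]] := exists_avoiding2 a c rK_gt2; rewrite inE => /andP[yK yD].
  exists (x |: K), (y |: rho K); split=> //; try split; rewrite !inE ?(negPf a1) ?(negPf c1) ?(negPf b1) ?(negPf e1) ?a2 ?b2 ?c2 ?e2 ?orbT ?orbF ?andbT // eq_sym //.
have [||a [b [c [e [abc [[aK cK bK eK]|[aK cK bK eK]]]]]]] := periodic_interlaced h_n lt_hn per per'.
- by rewrite card_imset //; exact: (dihedral_shift n l).1.
- by rewrite eq_sym.
- have [S [S' [SD S'D aS cS [bS eS]]]] := use a c b e aK cK bK eK.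
  by apply: (Dws _ _ SD S'D); left; exists a, b, c, e.
have [S [S' [SD S'D bS eS [aS cS]]]] := use b e a c bK eK aK cK.
by apply: (Dws _ _ SD S'D); right; exists a, b, c, e.
Qed.

Lemma free_card_dvd (A : {set {set 'I_n}}) : {in A, forall K, rho K \in A} ->
  (forall K j, K \in A -> 0 < j < d -> iter j rho K != K) -> d %| #|A|.
Proof.
move=> rhoA freeA; apply: card_orbits_dvd (@shift_set_inj n l) rhoA _ => K KA.
apply: order_eq; [exact: shift_set_inj|exact: period_gt0| |].
  rewrite iter_shift_set -[RHS](imset_id K); apply: eq_imset => i.
  by apply/eqP; rewrite shift_ord_fix dvdn_period.
by move=> j jd; apply: freeA.
Qed.

(** If no member and no common part of a white triangle is invariant, the
    rotation acts freely on members and on white polygons, so [d] divides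
    [k * (n - k) + 1] and [k * (n - k - 1)]. The first makes [d] coprime to [k];
    as [d] divides [n], the second leaves [d %| k.+1]. *)
Lemma necessity : [\/ d %| k.+1, d %| k | d %| k.-1].
Proof.
have [/existsP[S /andP[SD /eqP fixS]]|free] := boolP [exists S in D, rho S == S].
  by constructor 2; rewrite -(max_ws_card D_max SD); apply: shift_set_fixed_card.
have [/existsP[K /andP[K_gt2 /eqP fixK]]|freeK] := boolP [exists K, (2 < #|ext D K|) && (rho K == K)].
  constructor 3; have /card_gt0P[x xK] : 0 < #|ext D K| by apply: leq_trans K_gt2.
  by rewrite -(card_core D_max xK); apply: shift_set_fixed_card.
constructor 1; have [_ _ _ cardD] := D_max.
have d_n : d %| n by rewrite dvdn_div ?dvdn_gcdl.
have : d %| #|D|.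
  apply: free_card_dvd; first by move=> S SD; rewrite rho_mem.
  move=> S j SD jd; apply: contraNneq free => fixS.
  by apply/existsP; exists S; rewrite SD (fixed_mem SD jd fixS) eqxx.
have : d %| \sum_(K : {set 'I_n}) (#|ext D K| - 2).
  rewrite (partition_big (fun K => inord #|ext D K| : 'I_n.+1) xpredT) //=.
  have le_ext K : #|ext D K| < n.+1 by rewrite ltnS -[leqRHS]card_ord max_card.
  apply: dvdn_sum => v _.
  rewrite (eq_bigr (fun=> v - 2)) => [|K /eqP <-]; last by rewrite inordK.
  rewrite sum_nat_const; have [le_v2|v_gt2] := leqP v 2.
    by rewrite (_ : v - 2 = 0) ?muln0 //; apply/eqP.
  have vE K : (inord #|ext D K| == v) = (#|ext D K| == v :> nat).
    by rewrite -(inj_eq val_inj) /= inordK.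
  rewrite dvdn_mulr // (eq_card (B := [set K | #|ext D K| == v :> nat])) => [|K]; last by rewrite inE -vE.
  apply: free_card_dvd => K; first by rewrite !inE rho_ext card_imset //; exact: (dihedral_shift n l).1.
  move=> j; rewrite inE => /eqP eqv jd; apply: contraNneq freeK => fixK.
  have K_gt2 : 2 < #|ext D K| by rewrite eqv.
  by apply/existsP; exists K; rewrite K_gt2 (fixed_core K_gt2 jd fixK) eqxx.
rewrite (sum_ext D_max k_gt0 lt_kn) cardD => dvd1 dvd2.
have cop : coprime d k.
  rewrite /coprime -dvdn1 -(dvdn_addr (m := k * (n - k))); last first.
    by rewrite (dvdn_trans (dvdn_gcdr _ _)) ?dvdn_mulr.
  exact: dvdn_trans (dvdn_gcdl _ _) dvd2.
rewrite Gauss_dvdr // in dvd1.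
by rewrite -(dvdn_addr (m := n - k - 1)) // (_ : _ + _ = n) //; move: lt_kn; clear; lia.
Qed.

End Necessity.

(** * A symmetric maximum collection *)

Section Construction.
Variables (n g : nat).
Hypotheses (n_gt0 : 0 < n) (g_n : g %| n).

Let d := n %/ g.

(** The distance from [x] to [i] in the positive direction around the circle. *)
Definition offset (x i : 'I_n) : nat := if i < x then i + n - x else i - x.

Definition low_classes c := [set i : 'I_n | i %% g < c].

(** All residue classes modulo [g] below [c], a solid arc of length [Y] starting
    at [x], and the longer arc of length [Z] restricted to the class [c]. As [Z]
    grows, the sets of this form of a given size interpolate between arcs and
    sets containing the whole class [c]. *)
Definition arc_set c x Y Z :=
  [set i : 'I_n | [|| i %% g < c, offset x i < Y | (i %% g == c) && (offset x i < Z)]].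

Lemma offset_lt x i : offset x i < n.
Proof. by rewrite /offset; move: (ltn_ord x) (ltn_ord i); clear; case: (ltnP i x) => ?; lia. Qed.

Lemma separated_offset_ws (S T : {set 'I_n}) x u v :
  (forall i, i \in S -> i \notin T -> u <= offset x i < v) ->
  (forall i, i \in T -> i \notin S -> ~~ (u <= offset x i < v)) -> weakly_separated S T.
Proof.
move=> inS inT; have [f f_dih fE] := rotation_to x.
apply: (separated_ws (u := u) (v := v) f_dih) => i; rewrite inE => /andP[iT iS].
  by rewrite fE; apply: inS.
by rewrite fE; apply: inT.
Qed.

Lemma offset_change x x' i :
  offset x' i = if offset x i < offset x x' then offset x i + n - offset x x'
                else offset x i - offset x x'.
Proof.
rewrite /offset; move: (ltn_ord x) (ltn_ord x') (ltn_ord i); clear.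
by case: (ltnP i x) => ?; case: (ltnP x' x) => ?; case: (ltnP i x') => ? ? ? ?; case: ltnP; lia.
Qed.

Lemma arc_set_ws_near c x Y Z x' Y' Z' : Y <= Z -> Y' <= Z' -> offset x x' < Y ->
  weakly_separated (arc_set c x Y Z) (arc_set c x' Y' Z').
Proof.
move=> YZ YZ' near; set t := offset x x'; have lt_tn : t < n := offset_lt x x'.
have [le_z|lt_z] := leqP Z (t + Z').
  apply: (@separated_offset_ws _ _ x 0 Y) => i; rewrite !inE (offset_change x x') -/t;
  move: (offset_lt x i) near YZ YZ' lt_tn le_z; rewrite -/t; move: (offset x i) t => o t;
  case: (_ %% _ < c); case: (_ %% _ == c); case: (ltnP o t); clear; lia.
apply: ws_sym; apply: (@separated_offset_ws _ _ x Y (t + Y')) => i; rewrite !inE (offset_change x x') -/t;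
  move: (offset_lt x i) near YZ YZ' lt_tn lt_z; rewrite -/t; move: (offset x i) t => o t;
  case: (_ %% _ < c); case: (_ %% _ == c); case: (ltnP o t); clear; lia.
Qed.

(** In the coordinate starting at [x], one of the two differences is contained in
    an arc that the other avoids. Which arc depends on how far the two sparse
    parts reach, the sparse part of one set possibly wrapping around past [x]. *)
Lemma arc_set_ws c x Y Z x' Y' Z' : Y <= Z -> Y' <= Z' ->
  weakly_separated (arc_set c x Y Z) (arc_set c x' Y' Z').
Proof.
move=> YZ YZ'; have [near|far] := ltnP (offset x x') Y; first exact: arc_set_ws_near.
have [near|far'] := ltnP (offset x' x) Y'; first exact/ws_sym/arc_set_ws_near.
have far2 : offset x x' + Y' <= n \/ offset x x' = 0 /\ Y = 0 /\ Y' = 0.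
  move: far far'; rewrite /offset; move: (ltn_ord x) (ltn_ord x'); clear.
  by case: (ltnP x' x) => ?; case: (ltnP x x') => ?; lia.
set t := offset x x'; have lt_tn : t < n := offset_lt x x'.
have [lt_z|le_z] := ltnP (t + Z') Z.
  apply: ws_sym; apply: (@separated_offset_ws _ _ x t (t + Y')) => i; rewrite !inE (offset_change x x') -/t;
  move: (offset_lt x i) far far2 YZ YZ' lt_tn lt_z; rewrite -/t; move: (offset x i) t => o t;
  case: (_ %% _ < c); case: (_ %% _ == c); case: (ltnP o t); clear; lia.
have [le_z2|lt_z2] := leqP (t + Z') (Z + n).
  apply: (@separated_offset_ws _ _ x 0 t) => i; rewrite !inE (offset_change x x') -/t;
  move: (offset_lt x i) far far2 YZ YZ' lt_tn le_z le_z2; rewrite -/t; move: (offset x i) t => o t;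
  case: (_ %% _ < c); case: (_ %% _ == c); case: (ltnP o t); clear; lia.
apply: (@separated_offset_ws _ _ x 0 Y) => i; rewrite !inE (offset_change x x') -/t;
  move: (offset_lt x i) far far2 YZ YZ' lt_tn le_z lt_z2; rewrite -/t; move: (offset x i) t => o t;
  case: (_ %% _ < c); case: (_ %% _ == c); case: (ltnP o t); clear; lia.
Qed.

(** What the first set has beyond [T] lies in its solid arc, since the classes up
    to [c] are in [T]. *)
Lemma arc_set_ws_low c x Y Z (T : {set 'I_n}) : low_classes c.+1 \subset T ->
  weakly_separated (arc_set c x Y Z) T.
Proof.
move=> /subsetP low; apply: (@separated_offset_ws _ _ x 0 Y) => i; rewrite inE.
  move=> iS iT; apply: contraNT iT => oY; apply: low; rewrite inE ltnS leq_eqVlt orbC.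
  by move: iS; rewrite (negPf (oY : ~~ (offset x i < Y))) => /orP[->|/andP[-> _]]; rewrite ?orbT.
by move=> _; rewrite !negb_or => /and3P[_ + _].
Qed.

Lemma g_gt0 : 0 < g. Proof. exact: dvdn_gt0 g_n. Qed.

Lemma n_classes : n = g * d. Proof. by rewrite mulnC divnK. Qed.

Lemma card_low_classes c : c <= g -> #|low_classes c| = c * d.
Proof.
move=> le_cg; rewrite -sum1_card big_mkcond /=.
rewrite (eq_bigr (fun i : 'I_n => (i %% g < c : nat))) => [|i _]; last by rewrite inE; case: ifP.
rewrite -(big_mkord xpredT (fun i => (i %% g < c : nat))) [in LHS]n_classes.
elim: (d) => [|e IHe]; first by rewrite !muln0 big_geq.
rewrite mulnS addnC (big_cat_nat (n := g * e)) ?leq_addr //= IHe mulnS addnC; congr (_ + _).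
rewrite -{1}[g * e]add0n big_addn addKn.
rewrite (eq_big_nat _ _ (F2 := fun i => (i < c : nat))) => [|i /andP[_ lt_ig]]; last first.
  by rewrite addnC mulnC modnMDl modn_small.
rewrite big_mkord; elim: (g) le_cg => [|m IHm]; first by rewrite leqn0 big_ord0 => /eqP.
rewrite big_ord_recr /= leq_eqVlt => /orP[/eqP->|lt_cm]; last by rewrite IHm // ltnNge -ltnS lt_cm addn0.
by rewrite ltnSn (eq_bigr (fun=> 1)) ?sum_nat_const ?card_ord ?muln1 ?addn1 // => i _; rewrite ltnS ltnW.
Qed.

Lemma card_upper c : c <= g -> #|[set i : 'I_n | c <= i %% g]| = n - c * d.
Proof.
move=> le_cg; have := cardsC (low_classes c); rewrite card_low_classes // card_ord => /(canRL (addKn _)) <-.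
by apply: eq_card => i; rewrite !inE -leqNgt.
Qed.

Variables (k q : nat).
Hypotheses (le_kn : k <= n) (q_lo : q * d <= k) (q_hi : k <= q * d + 1).

Let d_gt0 : 0 < d. Proof. by rewrite divn_gt0 ?g_gt0 // dvdn_leq. Qed.

Let le_qg : q <= g.
Proof. by rewrite -(leq_pmul2r d_gt0) -n_classes (leq_trans q_lo). Qed.

Definition window_size (a x : 'I_n) := #|[set i : 'I_n | (a %% g <= i %% g) && (offset x i < offset x a)]|.

Definition starts (a : 'I_n) := [set x : 'I_n | (a %% g <= x %% g) && (k <= a %% g * d + window_size a x)].

(** Among the [n - c * d] elements whose class is at least the class [c] of [a],
    [window_size a] is a rank measured backwards from [a], so fewer than [k - c * d] of
    those different from [a] see a window too small. *)
Lemma card_starts (a : 'I_n) : a \in low_classes q -> n - k <= #|starts a|.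
Proof.
rewrite inE => lt_aq; set c := a %% g.
pose E := [set x : 'I_n | c <= x %% g] :\ a.
have cardE : #|E| = n - c * d - 1.
  have := cardsD1 a [set x : 'I_n | c <= x %% g].
  rewrite card_upper; last exact: ltnW (leq_trans lt_aq le_qg).
  by rewrite inE leqnn add1n => ->; rewrite subn1.
have winE x : x != a -> window_size a x = #|[set i in E | offset i a <= offset x a]|.
  move=> xa; congr #|pred_of_set _|; apply/setP=> i; rewrite !inE -/c -andbA [RHS]andbCA; congr (_ && _).
  move: xa; rewrite -!(inj_eq val_inj) /offset /=.
  move: (ltn_ord x) (ltn_ord i) (ltn_ord a); move: (x : nat) (i : nat) (a : nat) => v w u; clear.
  by case: (ltnP w v); case: (ltnP u v); case: (ltnP u w); lia.
pose bad := [set x in E | c * d + window_size a x < k].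
have card_bad : #|bad| <= k - c * d - 1.
  have [->|[x0 x0b]] := set_0Vmem bad; first by rewrite cards0.
  have := arg_maxnP (P := fun x => x \in bad) (fun x => offset x a) x0b => -[x xb max'].
  have max y : y \in bad -> offset y a <= offset x a := max' y.
  have : #|bad| <= window_size a x.
    move: (xb); rewrite inE => /andP[]; rewrite in_setD1 => /andP[xa _] _.
    rewrite winE //; apply/subset_leq_card/subsetP=> y yb; rewrite inE (max y yb) andbT.
    by move: yb; rewrite inE => /andP[].
  by move: xb; rewrite inE => /andP[_]; clear; lia.
have sub : E :\: bad \subset starts a.
  apply/subsetP=> x; rewrite !inE -/c negb_and -leqNgt.
  by move=> /andP[h /andP[xa xc]]; move: h; rewrite xa xc.
apply: leq_trans (subset_leq_card sub); rewrite cardsD cardE.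
have : #|E :&: bad| <= #|bad| by rewrite subset_leq_card ?subsetIr.
have : c.+1 * d <= q * d by rewrite leq_pmul2r.
by rewrite mulSn; move: q_lo card_bad d_gt0; clear; lia.
Qed.

(** For a sparse arc that ends just before [a], lengthening the solid arc adds at
    most one element at a time, from fewer than [k] elements to at least [k]. *)
Lemma arc_set_size (a x : 'I_n) : a \in low_classes q -> x \in starts a ->
  exists2 Y, 0 < Y <= offset x a & #|arc_set (a %% g) x Y (offset x a)| = k.
Proof.
rewrite !inE => lt_aq /andP[_ le_k]; set c := a %% g; set Z := offset x a.
have lt_cg : c < g by apply: leq_trans lt_aq le_qg.
pose G Y := #|arc_set c x Y Z|.
have G0 : G 0 < k.
  have : G 0 < #|low_classes c.+1|.
    apply: proper_card; apply/properP; split.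
      apply/subsetP=> i; rewrite !inE ltn0 /= ltnS [i %% g <= c]leq_eqVlt.
      by case/orP=> [->|/andP[-> _]]; rewrite ?orbT.
    by exists a; rewrite !inE -/c ?ltnSn // ltnn ltn0 /= ltnn andbF.
  have : c.+1 * d <= q * d by rewrite leq_pmul2r.
  by rewrite card_low_classes //; move: q_lo; clear; lia.
have GZ : k <= G Z.
  apply: leq_trans le_k _; rewrite -(card_low_classes (ltnW lt_cg)) /window_size -/c -/Z.
  rewrite -cardsUI (_ : _ :&: _ = set0); last first.
    by apply/setP=> i; rewrite !inE ltnNge; case: (c <= _); rewrite ?andbF.
  rewrite cards0 addn0 /G; apply/subset_leq_card/subsetP=> i; rewrite !inE.
  by case/orP=> [->|/andP[_ ->]]; rewrite ?orbT.
have GS Y : G Y.+1 <= G Y + 1.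
  have [f f_dih fE] := rotation_to x.
  have : #|arc_set c x Y.+1 Z :\: arc_set c x Y Z| <= 1.
    have offY i : i \in arc_set c x Y.+1 Z :\: arc_set c x Y Z -> f i = Y :> nat.
      rewrite fE -/(offset x i) !inE; clear.
      by case: (i %% g < c); case: ((i %% g == c) && (offset x i < Z)); lia.
    by apply/card_le1_eqP=> i j /offY iY /offY jY; apply: (pos_inj f_dih); rewrite iY jY.
  have := cardsID (arc_set c x Y Z) (arc_set c x Y.+1 Z); rewrite -/(G _).
  have : #|arc_set c x Y.+1 Z :&: arc_set c x Y Z| <= G Y by rewrite subset_leq_card ?subsetIr.
  by clear; lia.
have exY : exists Y, k <= G Y by exists Z.
have [Y kY minY] := ex_minnP exY; exists Y; last first.
  have Y_gt0 : 0 < Y by rewrite lt0n; apply: contraTneq kY => ->; rewrite -ltnNge.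
  have := minY Y.-1; have := GS Y.-1; rewrite prednK // -/(G Y).
  by move: kY Y_gt0; clear; case: (leqP k (G Y.-1)) => [? ? ? ? /(_ isT)|]; lia.
rewrite minY // andbT lt0n; apply: contraTneq kY => ->; by rewrite -ltnNge.
Qed.

(** The collection consists of nested layers, one for each class [c] below [q],
    around a centre made of the sets containing all classes below [q]. These sets,
    of size [k], have at most one further element, which is where the residue of
    [k] enters. *)
Definition in_layer (S : {set 'I_n}) := exists c x Y Z,
  [/\ c < q, Y <= Z, Z <= n & S = arc_set c x Y Z].

Definition family := [set S in ksubsets n k | (low_classes q \subset S) ||
  [exists p : 'I_q * 'I_n * ('I_n.+1 * 'I_n.+1),
    (p.2.1 <= p.2.2) && (S == arc_set p.1.1 p.1.2 p.2.1 p.2.2)]].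

Lemma familyP (S : {set 'I_n}) : reflect (#|S| = k /\ (low_classes q \subset S \/ in_layer S)) (S \in family).
Proof.
rewrite !inE; apply: (iffP andP) => [[/eqP Sk /orP lay]|[-> lay]]; split=> //.
  case: lay => [lowS|/existsP[[[c x] [Y Z]] /= /andP[YZ /eqP ->]]]; [by left|right].
  by exists c, x, Y, Z; split=> //; rewrite -ltnS.
apply/orP; case: lay => [|[c [x [Y [Z [cq YZ Zn ->]]]]]]; [by left|right].
have Yn := leq_trans YZ Zn; apply/existsP.
exists ((Ordinal cq, x), (Ordinal (Yn : Y < n.+1), Ordinal (Zn : Z < n.+1))).
by rewrite /= YZ eqxx.
Qed.

Lemma family_ws : weakly_separated_collection family.
Proof.
have low_mono c : c < q -> low_classes c.+1 \subset low_classes q.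
  by move=> cq; apply/subsetP=> i; rewrite !inE => /leq_trans; apply.
have sub_low c x Y Z : low_classes c \subset arc_set c x Y Z.
  by apply/subsetP=> i; rewrite !inE => ->.
have layer_low (S T : {set 'I_n}) : in_layer S -> low_classes q \subset T -> weakly_separated S T.
  move=> [c [x [Y [Z [cq YZ _ ->]]]]] lowT; apply: arc_set_ws_low.
  exact: subset_trans (low_mono c cq) lowT.
move=> S T /familyP[Sk Scase] /familyP[Tk Tcase].
case: Scase Tcase => [lowS|layS] [lowT|layT].
- apply/wsP => a c b e aD cD _ _; suff -> : a = c by rewrite /between; clear; lia.
  have : #|S :\: T| <= 1.
    apply: leq_trans (subset_leq_card (setDS S lowT)) _.
    by rewrite cardsD (setIidPr lowS) card_low_classes // Sk; move: q_hi; clear; lia.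
  by move/card_le1_eqP; apply.
- exact/ws_sym/layer_low.
- exact: layer_low.
case: layS layT => [c [x [Y [Z [cq YZ _ ->]]]]] [c' [x' [Y' [Z' [c'q Y'Z' _ ->]]]]].
have [lt|lt|->] := ltngtP c c'; last exact: arc_set_ws.
  apply: arc_set_ws_low; apply: subset_trans (sub_low c' x' Y' Z').
  by apply/subsetP=> i; rewrite !inE => /leq_trans; apply.
apply/ws_sym/arc_set_ws_low; apply: subset_trans (sub_low c x Y Z).
by apply/subsetP=> i; rewrite !inE => /leq_trans; apply.
Qed.

Lemma offset_shift l x i : offset (shift_ord l x) (shift_ord l i) = offset x i.
Proof.
rewrite /offset !val_shift.
move: (ltn_ord x) (ltn_ord i) (ltn_pmod l n_gt0); move: (l %% n) => t; clear=> ? ? ?.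
by case: (ltnP (x + t)) => ?; case: (ltnP (i + t)) => ?; case: (ltnP i x) => ?; case: ltnP; lia.
Qed.

Lemma family_rho l : g %| l -> rho_symmetric l family.
Proof.
move=> g_l; have shift_inj := (dihedral_shift n l).1.
have modE (i : 'I_n) : shift_ord l i %% g = i %% g.
  by rewrite /= modn_dvdm // -modnDmr (eqP g_l) addn0.
have [h hK shiftK] := injF_bij shift_inj.
move=> S /familyP[Sk Scase]; apply/familyP; split; first by rewrite card_imset.
case: Scase => [lowS|[c [x [Y [Z [cq YZ Zn ->]]]]]]; [left|right].
  apply/subsetP=> i; rewrite -[i]shiftK mem_shift_set inE modE => lt.
  by apply: (subsetP lowS); rewrite inE.
exists c, (shift_ord l x), Y, Z; split=> //; apply/setP=> i.
by rewrite -[i]shiftK mem_shift_set !inE modE offset_shift.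
Qed.

(** Each pair of an element [a] of a class below [q] and a start [x] gives a
    member outside the centre. The member determines the pair: its class is the
    first one not contained in it, and [a] is the first missing element of that
    class after [x]; two different starts would each force the missing element of
    the other pair to come before its own. *)
Lemma card_family : q * d * (n - k) + #|[set S in family | low_classes q \subset S]| <= #|family|.
Proof.
pose index := [set p : 'I_n * 'I_n | (p.1 \in low_classes q) && (p.2 \in starts p.1)].
pose good (p : 'I_n * 'I_n) (S : {set 'I_n}) := [exists Y : 'I_n.+1,
  (0 < Y <= offset p.2 p.1) && (S == arc_set (p.1 %% g) p.2 Y (offset p.2 p.1))].
pose phi p := odflt set0 [pick S in family | good p S].
have phiP p : p \in index -> phi p \in family /\ good p (phi p).
  case: p => a x; rewrite inE /= => /andP[aq xa]; rewrite /phi; case: pickP => [S /andP[]//|none].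
  have [Y Yle sizeY] := arc_set_size aq xa.
  have Yn : Y < n.+1 by case/andP: Yle => _ le; rewrite ltnS (leq_trans le) // ltnW // offset_lt.
  have := none (arc_set (a %% g) x Y (offset x a)).
  rewrite (_ : good _ _) ?andbT; last by apply/existsP; exists (Ordinal Yn); rewrite Yle eqxx.
  case/familyP; split=> //; right; exists (a %% g), x, Y, (offset x a).
  by case/andP: Yle => _ ->; rewrite inE in aq; split=> //; apply/ltnW/offset_lt.
have goodE a x (S : {set 'I_n}) : good (a, x) S -> [/\ a \notin S, low_classes (a %% g) \subset S,
   a %% g <= x %% g -> x \in S, (forall i : 'I_n, i %% g = a %% g -> i \notin S -> offset x a <= offset x i) &
   (forall i : 'I_n, a %% g <= i %% g -> i \in S -> offset x i < offset x a)].
  case/existsP=> Y /= /andP[/andP[Y_gt0 YZ] /eqP ->]; split.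
  - by rewrite !inE eqxx !ltnn /= orbF -leqNgt.
  - by apply/subsetP=> i; rewrite !inE => ->.
  - by move=> _; rewrite !inE /offset ltnn subnn Y_gt0 orbT.
  - by move=> i eqi; rewrite !inE eqi eqxx /= !negb_or -!leqNgt => /and3P[].
  - move=> i lei; rewrite !inE ltnNge lei /= => /orP[|/andP[] //]; move: YZ; clear; lia.
have phi_inj : {in index &, injective phi}.
  have class_le a x a' x' S : good (a, x) S -> good (a', x') S -> a' %% g <= a %% g.
    move=> /goodE[aS _ _ _ _] /goodE[_ /subsetP low _ _ _]; rewrite leqNgt.
    by apply: contraNN aS => lt; apply: low; rewrite inE.
  move=> [a x] [a' x'] pI p'I eq_phi.
  have [_ g1] := phiP _ pI; have [_ g2] := phiP _ p'I; rewrite -eq_phi in g2.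
  move: pI p'I; rewrite !inE /= => /andP[aq /andP[ax _]] /andP[a'q /andP[a'x' _]].
  have eq_class : a %% g = a' %% g.
    by apply/eqP; rewrite eqn_leq (class_le _ _ _ _ _ g1 g2) (class_le _ _ _ _ _ g2 g1).
  have [aS _ /(_ ax) xS minA maxA] := goodE _ _ _ g1.
  have [a'S _ /(_ a'x') x'S minA' maxA'] := goodE _ _ _ g2.
  have le_aa' := minA a' (esym eq_class) a'S.
  have lt_x' : offset x x' < offset x a by apply: maxA; rewrite // eq_class.
  have lt_x : offset x' x < offset x' a' by apply: maxA'; rewrite // -eq_class.
  have offset_inj y i j : offset y i = offset y j -> i = j.
    move=> eq; apply: val_inj; move: eq; rewrite /offset /=.
    move: (ltn_ord y) (ltn_ord i) (ltn_ord j); clear.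
    by case: (ltnP i y) => ?; case: (ltnP j y) => ?; lia.
  have offset0 y : offset y y = 0 by rewrite /offset ltnn subnn.
  have t0 : offset x x' = 0.
    move: lt_x; rewrite !(offset_change x x') offset0.
    move: le_aa' lt_x' (offset_lt x a'); clear; case: (posnP (offset x x')) => // t_gt0.
    by case: (ltnP (offset x a') (offset x x')) => /=; lia.
  have eqx : x = x' by apply/esym/(offset_inj x); rewrite t0 offset0.
  subst x'; congr (_, _); apply: (offset_inj x); apply/eqP; rewrite eqn_leq le_aa' /=.
  exact: minA'.
have card_index : q * d * (n - k) <= #|index|.
  rewrite -card_low_classes // -sum_nat_const -[leqRHS]sum1_card.
  rewrite (eq_bigl (fun p => (p.1 \in low_classes q) && (p.2 \in starts p.1))); last first.
    by move=> p; rewrite inE.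
  rewrite -(pair_big_dep (fun a => a \in low_classes q) (fun a x => x \in starts a) (fun _ _ => 1)) /=.
  by apply: leq_sum => a aq; rewrite sum1_card; apply: card_starts.
rewrite -(cardsID [set S : {set 'I_n} | low_classes q \subset S] family) addnC.
rewrite (_ : _ :&: _ = [set S in family | low_classes q \subset S]); last first.
  by apply/setP=> S; rewrite !inE.
rewrite leq_add2l (leq_trans card_index) // -(card_in_imset phi_inj).
apply/subset_leq_card/subsetP=> _ /imsetP[[a x] pI ->]; have [phiF g1] := phiP _ pI.
rewrite in_setD phiF andbT inE; apply/subsetPn; exists a.
  by move: pI; rewrite inE => /andP[].
by have [] := goodE _ _ _ g1.
Qed.

End Construction.

(** There are at least [q * d * (n - k)] members outside the centre. The centre has one
    member when [k = q * d] and [n - q * d] members when [k = q * d + 1]; in both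
    cases the size bound is attained. *)
Lemma symmetric_max_ws n k l : 0 < n -> k <= n ->
  (n %/ gcdn n l %| k) \/ (0 < k /\ n %/ gcdn n l %| k.-1) ->
  exists2 D : {set {set 'I_n}}, max_ws k D & rho_symmetric l D.
Proof.
move=> n_gt0 le_kn; set g := gcdn n l; set d := n %/ g => div_k.
have g_n : g %| n := dvdn_gcdl n l.
have build q : q * d <= k -> k <= q * d + 1 ->
    k * (n - k) + 1 <= q * d * (n - k) + #|[set S in family n g k q | low_classes n g q \subset S]| ->
  exists2 D : {set {set 'I_n}}, max_ws k D & rho_symmetric l D.
  move=> q_lo q_hi card_center; exists (family n g k q); last first.
    exact/family_rho/dvdn_gcdr.
  have fam_k : family n g k q \subset ksubsets n k by apply/subsetP=> S; rewrite inE => /andP[].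
  have fam_ws : weakly_separated_collection (family n g k q) by apply: family_ws.
  split=> //; apply/eqP; rewrite eqn_leq (ws_card_le (dihedral_id n)) //=.
  by apply: leq_trans card_center _; apply: card_family.
have g_gt0 : 0 < g := dvdn_gt0 n_gt0 g_n.
have d_gt0 : 0 < d by rewrite divn_gt0 // dvdn_leq.
have center q (S : {set 'I_n}) : q * d <= k -> k <= q * d + 1 -> #|S| = k ->
    low_classes n g q \subset S -> S \in [set S in family n g k q | low_classes n g q \subset S].
  by move=> q_lo q_hi Sk lowS; rewrite inE lowS andbT; apply/familyP => //; split=> //; left.
have card_low q : q * d <= k -> #|low_classes n g q| = q * d.
  move=> q_lo; apply: card_low_classes => //.
  by rewrite -(leq_pmul2r d_gt0) [g * d]mulnC divnK // (leq_trans q_lo).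
case: div_k => [/dvdnP[q kE]|[k_gt0 /dvdnP[q kE]]].
  have [q_lo q_hi] : q * d <= k /\ k <= q * d + 1 by rewrite kE leq_addr.
  apply: (build q) => //; rewrite -{1}kE leq_add2l card_gt0; apply/set0Pn.
  by exists (low_classes n g q); apply: center; rewrite ?card_low.
have {}kE : k = q * d + 1 by rewrite -kE addn1 prednK.
have [q_lo q_hi] : q * d <= k /\ k <= q * d + 1 by rewrite kE leq_addr.
apply: (build q) => //.
have sub : [set i |: low_classes n g q | i in ~: low_classes n g q] \subset
    [set S in family n g k q | low_classes n g q \subset S].
  apply/subsetP=> _ /imsetP[i + ->]; rewrite inE => iq; apply: center => //.
    by rewrite cardsU1 iq card_low // kE addnC.
  exact: subsetUr.
apply: leq_trans (leq_add (leqnn _) (subset_leq_card sub)).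
rewrite card_in_imset => [|i j]; last first.
  rewrite !inE => iq jq /setP/(_ i); rewrite !inE eqxx /= (negPf iq) orbF.
  by move/esym/eqP.
have := cardsC (low_classes n g q); rewrite card_ord card_low // => /(canRL (addKn _)) ->.
by rewrite [in k * _]kE mulnDl mul1n; move: le_kn kE; clear; lia.
Qed.

Lemma rho_symmetric_compl n l (D : {set {set 'I_n}}) :
  rho_symmetric l D -> rho_symmetric l [set ~: S | S in D].
Proof.
move=> D_rho _ /imsetP[S SD ->]; apply/imsetP; exists (shift_set l S); first exact: D_rho.
have [h hK shiftK] := injF_bij (dihedral_shift n l).1.
by apply/setP=> i; rewrite -[i]shiftK !inE !mem_shift_set inE.
Qed.


(** * The characterisation *)

Theorem theorem1p2 (k n l : nat) (k_gt0 : 0 < k) (n_gt0 : 0 < n)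
    (l_gt0 : 0 < l) (le_kn : k <= n) :
  let d := n %/ gcdn n l in
  (exists D : {set {set 'I_n}},
     [/\ D \subset ksubsets n k,
         weakly_separated_collection D,
         rho_symmetric l D
       & #|D| = k * (n - k) + 1])
  <->
  [\/ (k%:Z = -1 %[mod d%:Z])%Z,
      (k%:Z = 0 %[mod d%:Z])%Z
    | (k%:Z = 1 %[mod d%:Z])%Z].
Proof.
move=> d.
have d_n : d %| n by rewrite dvdn_div ?dvdn_gcdl.
have modN1 : (k%:Z = -1 %[mod d%:Z])%Z <-> d %| k.+1.
  rewrite (rwP eqP) eqz_mod_dvd (_ : (Posz k - -1)%R = Posz k.+1); last by clear; lia.
  by [].
have mod0 : (k%:Z = 0 %[mod d%:Z])%Z <-> d %| k.
  by rewrite (rwP eqP) eqz_mod_dvd GRing.subr0.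
have mod1 : (k%:Z = 1 %[mod d%:Z])%Z <-> d %| k.-1.
  rewrite (rwP eqP) eqz_mod_dvd (_ : (Posz k - 1)%R = Posz k.-1); last by move: k_gt0; clear; lia.
  by [].
split=> [[D [Dk Dws D_rho cardD]]|].
  have D_max : max_ws k D by [].
  move: le_kn; rewrite leq_eqVlt => /orP[/eqP eq_kn|lt_kn].
    by constructor 2; apply/mod0; rewrite eq_kn.
  by have [/modN1|/mod0|/mod1] := necessity D_max D_rho k_gt0 lt_kn; [constructor 1|constructor 2|constructor 3].
have unpack : (exists2 D : {set {set 'I_n}}, max_ws k D & rho_symmetric l D) ->
    exists D : {set {set 'I_n}}, [/\ D \subset ksubsets n k, weakly_separated_collection D,
      rho_symmetric l D & #|D| = k * (n - k) + 1].
  by case=> D [_ Dk Dws cardD] D_rho; exists D.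
case=> [/modN1 dvd_k1|/mod0 dvd_k|/mod1 dvd_k1]; apply: unpack.
- have := le_kn; rewrite leq_eqVlt => /orP[/eqP eq_kn|lt_kn].
    by apply: symmetric_max_ws => //; left; rewrite [in X in _ %| X]eq_kn.
  have [|D D_max D_rho] := @symmetric_max_ws n (n - k) l n_gt0 (leq_subr _ _).
    right; split; first by rewrite subn_gt0.
    by rewrite -subnS dvdn_sub.
  exists [set ~: S | S in D]; last exact: rho_symmetric_compl.
  by have := max_ws_compl D_max; rewrite subKn.
- by apply: symmetric_max_ws => //; left.
- by apply: symmetric_max_ws => //; right.
Qed.
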